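(* Let $(X,\mu)$ be a non-atomic probability space equipped with a tree $\mathcal{T}$, with associated maximal operator $\mathcal{M}_{\mathcal{T}}$, let $p>1$ and $q\in[1,p]$. Let $\phi\in L^p(X,\mu)$ be non-negative with $\int_X\phi\,d\mu=f$. Then for every $\beta>0$ $$\int_X(\mathcal{M}_{\mathcal{T}}\phi)^p\,d\mu\ \le\ -\frac{q(\beta+1)}{(p-1)q\beta+(p-q)}\,f^p+\frac{p(\beta+1)^q}{(p-1)q\beta+(p-q)}\int_X\phi^q(\mathcal{M}_{\mathcal{T}}\phi)^{p-q}\,d\mu .$$ Additionally, this inequality is best possible for any given $q\in[1,p]$, $f>0$ and $\beta$ with $0<\beta\le\frac{1}{p-1}$, in the following sense: if the second constant $\frac{p(\beta+1)^q}{(p-1)q\beta+(p-q)}$ is kept fixed, the absolute value of the first constant cannot be increased; that is, for every $C>\frac{q(\beta+1)}{(p-1)q\beta+(p-q)}$ there is a non-negative $\phi\in L^p(X,\mu)$ with $\int_X\phi\,d\mu=f$ such that $$\int_X(\mathcal{M}_{\mathcal{T}}\phi)^p\,d\mu\ >\ -C f^p+\frac{p(\beta+1)^q}{(p-1)q\beta+(p-q)}\int_X\phi^q(\mathcal{M}_{\mathcal{T}}\phi)^{p-q}\,d\mu .$$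
   Context: Let $(X,\mu)$ be a non-atomic probability space. A set $\mathcal{T}$ of measurable subsets of $X$ is called a tree if: (i) $X\in\mathcal{T}$ and $\mu(I)>0$ for every $I\in\mathcal{T}$; (ii) to every $I\in\mathcal{T}$ there corresponds a finite or countable subset $C(I)\subseteq\mathcal{T}$ containing at least two elements, such that the elements of $C(I)$ are pairwise disjoint subsets of $I$ and $I=\bigcup C(I)$; (iii) $\mathcal{T}=\bigcup_{m\ge0}\mathcal{T}_{(m)}$, where $\mathcal{T}_{(0)}=\{X\}$ and $\mathcal{T}_{(m+1)}=\bigcup_{I\in\mathcal{T}_{(m)}}C(I)$; (iv) $\lim_{m\to\infty}\sup_{I\in\mathcal{T}_{(m)}}\mu(I)=0$; (v) $\mathcal{T}$ differentiates $L^1(X,\mu)$, i.e. for every $\phi\in L^1(X,\mu)$, for $\mu$-almost every $x\in X$, $\frac{1}{\mu(I)}\int_I\phi\,d\mu\to\phi(x)$ as $\mu(I)\to0$ with $x\in I\in\mathcal{T}$. The associated maximal operator is $\mathcal{M}_{\mathcal{T}}\phi(x)=\sup\left\{\frac{1}{\mu(I)}\int_I|\phi|\,d\mu:\ x\in I\in\mathcal{T}\right\}$ for $\phi\in L^1(X,\mu)$. *)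

(* Defs.v *)
From HB Require Import structures.
From mathcomp Require Import all_boot all_order all_algebra.
From mathcomp Require Import all_classical all_reals all_analysis.

Set Implicit Arguments.
Unset Strict Implicit.
Unset Printing Implicit Defensive.

Import Order.TTheory GRing.Theory Num.Theory.
Import numFieldNormedType.Exports.

Local Open Scope classical_set_scope.
Local Open Scope ring_scope.

Definition non_atomic (d : measure_display) (X : measurableType d)
    (R : realType) (mu : probability X R) : Prop :=
  forall A : set X, measurable A -> (0 < mu A)%E ->
    exists B : set X,
      [/\ measurable B, B `<=` A, (0 < mu B)%E & (mu B < mu A)%E].

Fixpoint tree_level (X : Type) (C : set X -> set (set X)) (m : nat) :
    set (set X) :=
  if m is m'.+1 then \bigcup_(I in tree_level C m') C I else [set setT].

(* Convergence of the averages as mu I -> 0, I ranging over the members of T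
   that contain x. *)
Definition differentiates_L1 (d : measure_display) (X : measurableType d)
    (R : realType) (mu : probability X R) (T : set (set X)) : Prop :=
  forall phi : X -> R, phi \in Lfun mu 1%:E ->
    {ae mu, forall x : X, forall e : R, 0 < e ->
      exists2 delta : R, 0 < delta &
        forall I : set X, T I -> I x -> (mu I < delta%:E)%E ->
          `| (fine (mu I))^-1 * (\int[mu]_(y in I) phi y)%R - phi x | < e}.

(* The children map C is only constrained on T. *)
Record is_tree_with (d : measure_display) (X : measurableType d)
    (R : realType) (mu : probability X R)
    (T : set (set X)) (C : set X -> set (set X)) : Prop := IsTreeWith {
  tree_root : T setT ;
  tree_measurable : forall I, T I -> measurable I ;
  tree_pos : forall I, T I -> (0 < mu I)%E ;
  tree_children_sub : forall I, T I -> C I `<=` T ;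
  tree_children_countable : forall I, T I -> countable (C I) ;
  tree_children_two : forall I, T I ->
    exists J K : set X, [/\ C I J, C I K & J <> K] ;
  tree_children_disjoint : forall I, T I -> trivIset (C I) id ;
  tree_children_subset : forall I, T I -> forall J, C I J -> J `<=` I ;
  tree_children_cover : forall I, T I -> I = \bigcup_(J in C I) J ;
  tree_levels : T = \bigcup_m tree_level C m ;
  tree_mesh :
    ereal_sup [set mu I | I in tree_level C m] @[m --> \oo] --> 0%E ;
  tree_differentiates : differentiates_L1 mu T }.

Definition is_tree (d : measure_display) (X : measurableType d)
    (R : realType) (mu : probability X R) (T : set (set X)) : Prop :=
  exists C : set X -> set (set X), is_tree_with mu T C.

(* Extended-real valued: M phi x may be +oo on a null set, even for phi in L^p,
   where the convention +oo `^ 0 = 1 of poweR is then harmless. *)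
Definition tree_maximal (d : measure_display) (X : measurableType d)
    (R : realType) (mu : probability X R) (T : set (set X))
    (phi : X -> R) (x : X) : \bar R :=
  ereal_sup
    [set ((mu I)^-1 * \int[mu]_(y in I) `|phi y|%:E)%E
      | I in [set I : set X | T I /\ I x]].

(* Main.v *)
Require Import Defs.
From HB Require Import structures.
From mathcomp Require Import all_boot all_order all_algebra.
From mathcomp Require Import all_classical all_reals all_analysis.
From mathcomp Require Import measurable_realfun.
From mathcomp Require Import ring lra.

Set Implicit Arguments.
Unset Strict Implicit.
Unset Printing Implicit Defensive.

Import Order.TTheory GRing.Theory Num.Theory.
Import numFieldNormedType.Exports.

Local Open Scope classical_set_scope.
Local Open Scope ring_scope.

(** Both halves turn on the configuration in which the maximal function [M] of
[phi] equals [(beta + 1) * phi].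

The inequality. Let [s_m x] be the average of [phi] over the cell of level [m]
that contains [x]; the maximal function is the supremum of the [s_m], hence of
the running maxima [max (s_0, ..., s_m)]. When the running maximum rises from
[t] to [t' = s_(m+1)], convexity of the power function gives
[t'^p - t^p <= p/(p-1) * s_(m+1) * (t'^(p-1) - t^(p-1))]. The increment on the
right is constant on the cells of level [m+1], so under the integral [s_(m+1)]
can be replaced by [phi], and the sum over [m] telescopes to
  [int M^p + f^p/(p-1) <= p/(p-1) * int phi * M^(p-1)],
which is the case [q = 1] (lemma [capped_max_linear]). Young's inequality,
weighted so that it is an equality at [M = (beta + 1) * phi], bounds
[phi * M^(p-1)] by a combination of [phi^q * M^(p-q)] and [M^p]; moving the
latter to the left yields exactly the two constants of the theorem
([capped_max_power]). This last step subtracts an integral that has to be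
finite, so the running maxima are first cut off at a finite height, and the
height and the level tend to infinity together ([tree_maximal_bound]).

Sharpness. On the unit interval the extremal functions are powers [t^(-s)]. In a
tree they are imitated by functions that grow geometrically along nested unions
of cells. Fix [theta < 1]. The mesh of the tree tends to 0, so every cell
contains a disjoint family of cells that fills exactly the proportion [theta] of
it; iterating from the root gives families [S_0 = {X}, S_1, S_2, ...] with
unions [E_0, E_1, E_2, ...] ([sparse_families]). For [phi = A * gam^n] on
[E_n \ E_(n+1)] the average over a cell of [S_n] is a fixed multiple [rho] of
[A * gam^n], whence [rho * phi <= M], and [int phi] and [int phi^p] are
geometric series ([extremal_function]). No upper bound for [M] is needed:
[t^p - K * phi^q * t^(p-q)] increases with [t] on [t >= rho * phi], and therefore
  [int M^p - K * int phi^q * M^(p-q) >= (rho^p - K * rho^(p-q)) * int phi^p].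
The right-hand side exceeds [- C * f^p] once [rho] is slightly smaller than
[beta + 1] and [theta] is close enough to 1 ([extremal_parameters]). *)

(** * Power inequalities *)

(** The concave function [y |-> y ^ r] lies below its tangent at 1. Both
[powR_young] and [powR_maximal_trade] are instances of this bound. *)
Lemma powR_le_tangent (R : realType) (y r : R) :
  0 <= y -> 0 <= r -> r <= 1 -> y `^ r <= 1 + r * (y - 1).
Proof.
rewrite le_eqVlt => /predU1P[<-|y0] r0 r1.
  have [->|rN0] := eqVneq r 0; first by rewrite powRr0 mul0r addr0.
  by rewrite powR0// sub0r mulrN1 subr_ge0.
set s := ln y; have yE : y = expR s by rewrite lnK.
have -> : y `^ r = expR (r * s) by rewrite /powR gt_eqF.
set e := expR (r * s).
have e0 : 0 < e := expR_gt0 _.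
(* Tangent of the exponential at [r * s], to be used at [c = s] and at [c = 0]. *)
have tangent (c : R) : e * (1 + (c - r * s)) <= expR c.
  have -> : expR c = e * expR (c - r * s) by rewrite -expRD addrCA subrr addr0.
  by rewrite ler_pM2l// expR_ge1Dx.
have h1 := ler_wpM2l r0 (tangent s).
have h2 : (1 - r) * (e * (1 + (0 - r * s))) <= (1 - r) * 1.
  by rewrite ler_wpM2l ?subr_ge0//; have := tangent 0; rewrite expR0.
rewrite yE; apply: le_trans (_ : r * expR s + (1 - r) * 1 <= _); last by lra.
by apply: le_trans (lerD h1 h2); rewrite le_eqVlt; apply/orP; left; apply/eqP; ring.
Qed.

(** Young's inequality in homogeneous form. The weight [b] is chosen so that
equality holds when [m = b * x]. *)
Lemma powR_young (R : realType) (p q b x m : R) :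
  1 < p -> 1 <= q -> 0 < b -> 0 <= x -> 0 <= m ->
  x * m `^ (p - 1) <=
    b `^ (q - 1) / q * (x `^ q * m `^ (p - q)) + (q - 1) / (q * b) * m `^ p.
Proof.
move=> p1 q1 b0 x0; rewrite le_eqVlt => /predU1P[<-|m0].
  rewrite (powR0 (x := p - 1)) ?subr_eq0 ?gt_eqF// mulr0.
  have q0 : 0 <= q by apply: le_trans q1.
  have b'0 := ltW b0.
  by rewrite addr_ge0// !mulr_ge0 ?invr_ge0 ?mulr_ge0 ?powR_ge0 ?subr_ge0.
have q0 : 0 < q by apply: lt_le_trans q1.
set t := b * x / m.
have t0 : 0 <= t by exact: divr_ge0 (mulr_ge0 (ltW b0) x0) (ltW m0).
have qV0 : 0 <= q^-1 by rewrite invr_ge0 ltW.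
have qV1 : q^-1 <= 1 by rewrite invf_le1.
have := @powR_le_tangent _ (t `^ q) q^-1 (powR_ge0 _ _) qV0 qV1.
rewrite -powRrM divff ?gt_eqF// powRr1//.
have -> : t `^ q = b * b `^ (q - 1) * x `^ q / m `^ q.
  rewrite /t (powRM _ (mulr_ge0 (ltW b0) x0)) ?invr_ge0 ?(ltW m0)//.
  rewrite (powRM _ (ltW b0))// mulr_powRB1 ?(ltW b0)//.
  by rewrite -(powR_inv1 (ltW m0)) -powRrM mulN1r powRN.
have -> : m `^ (p - q) = m `^ p / m `^ q by rewrite powRB// (gt_eqF m0) implybT.
have -> : m `^ (p - 1) = m `^ p / m by rewrite powRB ?(gt_eqF m0) ?implybT// powRr1// ltW.
move=> h; have mp : 0 < m `^ p / b by rewrite divr_gt0// powR_gt0.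
have := ler_wpM2l (ltW mp) h; rewrite /t => {}h.
have mq : 0 < m `^ q by rewrite powR_gt0.
apply: le_trans (_ : m `^ p / b * (b * x / m) <= _).
  by rewrite le_eqVlt; apply/orP; left; apply/eqP; field; rewrite !gt_eqF.
apply: (le_trans h).
by rewrite le_eqVlt; apply/orP; left; apply/eqP; field; rewrite !gt_eqF.
Qed.

(** Up to the factor [p / (p - 1)], [s] times the increment of [t ^ (p - 1)] controls
the increment of [t ^ p], because [t ^ p] has derivative
[p / (p - 1) * t * (t ^ (p - 1))'] and [t] stays below [s]. *)
Lemma powR_sub_le (R : realType) (p m m' s : R) :
  1 < p -> 0 <= m -> m <= m' -> m' <= s ->
  m' `^ p - m `^ p <= p / (p - 1) * (s * (m' `^ (p - 1) - m `^ (p - 1))).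
Proof.
move=> p1 m0 mm' m's.
have m'0 := le_trans m0 mm'.
have p0 : 0 < p by apply: lt_trans p1.
have p10 : 0 < p - 1 by rewrite subr_gt0.
have := powR_young p1 (ltW p1) ltr01 m'0 m0.
rewrite powR1 subrr powRr0 !mulr1 mul1r => h.
apply: le_trans (_ : p / (p - 1) * (m' * (m' `^ (p - 1) - m `^ (p - 1))) <= _).
  rewrite mulrBr mulr_powRB1//.
  have := ler_wpM2l (ltW (divr_gt0 p0 p10)) h.
  have -> : p / (p - 1) * (p^-1 * m' `^ p + (p - 1) / p * m `^ p) =
      p / (p - 1) * m' `^ p - (m' `^ p - m `^ p).
    by field; rewrite !gt_eqF.
  lra.
rewrite (ler_wpM2l (ltW (divr_gt0 p0 p10)))//.
by rewrite ler_wpM2r ?subr_ge0// ge0_ler_powR ?nnegrE// ltW.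
Qed.

(** The function [t |-> t ^ p - K * y ^ q * t ^ (p - q)] is nondecreasing on
[t >= rho * y], since the hypothesis on [K] says that its derivative is
nonnegative at [rho * y]. The inequality compares its values at [t] and at
[rho * y]. *)
Lemma powR_maximal_trade (R : realType) (p q K rho y t : R) :
  1 < p -> 1 <= q -> q <= p -> 0 <= K -> 0 < rho ->
  K * (p - q) / p <= rho `^ q -> 0 <= y -> rho * y <= t ->
  K * (y `^ q * t `^ (p - q))
    <= t `^ p + (K * rho `^ (p - q) - rho `^ p) * y `^ p.
Proof.
move=> p1 q1 qp K0 rho0 Krho.
have p0 : 0 < p by apply: lt_trans p1.
have q0 : 0 < q by apply: lt_le_trans q1.
rewrite le_eqVlt => /predU1P[<- _|y0 ryt].
  by rewrite !powR0 ?gt_eqF// mul0r !mulr0 addr0 powR_ge0.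
have ry0 : 0 < rho * y by rewrite mulr_gt0.
have t0 := lt_le_trans ry0 ryt.
set s := t / (rho * y).
have s1 : 1 <= s by rewrite ler_pdivlMr// mul1r.
have s0 : 0 <= s by apply: le_trans s1.
have -> : t = s * rho * y by rewrite /s; field; rewrite !gt_eqF.
have sr0 : 0 <= s * rho by rewrite mulr_ge0// ltW.
rewrite !(powRM _ sr0 (ltW y0)) !(powRM _ s0 (ltW rho0)).
have -> : y `^ p = y `^ q * y `^ (p - q).
  by rewrite -powRD ?(gt_eqF y0) ?implybT// addrC subrK.
have -> : rho `^ p = rho `^ q * rho `^ (p - q).
  by rewrite -powRD ?(gt_eqF rho0) ?implybT// addrC subrK.
set r := (p - q) / p.
have r0 : 0 <= r by rewrite divr_ge0 ?subr_ge0// ltW.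
have r1 : r <= 1 by rewrite ler_pdivrMr// mul1r; lra.
have sp1 : 1 <= s `^ p by rewrite -(powRr0 s) ler_powR// ltW.
have := @powR_le_tangent _ (s `^ p) r (powR_ge0 _ _) r0 r1.
rewrite -powRrM /r mulrC divfK ?gt_eqF// -/r.
set S := s `^ (p - q); set Sp := s `^ p => hS.
set Y := y `^ q * y `^ (p - q).
set G := rho `^ (p - q); set Q := rho `^ q.
have key : K * (S - 1) <= Q * (Sp - 1).
  apply: le_trans (_ : K * (r * (Sp - 1)) <= _).
    by rewrite ler_wpM2l//; rewrite lerBlDl.
  by rewrite mulrA ler_wpM2r ?subr_ge0// /r mulrA.
have G0 : 0 <= G := powR_ge0 _ _.
have Y0 : 0 <= Y by rewrite mulr_ge0 ?powR_ge0.
have := ler_wpM2l (mulr_ge0 G0 Y0) key.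
rewrite -subr_le0 => hh.
rewrite -subr_le0; apply: le_trans hh.
by rewrite le_eqVlt; apply/orP; left; apply/eqP; rewrite /Y; ring.
Qed.

Lemma powR_one_add_bounds (R : realType) (delta q : R) :
  0 <= delta -> 0 < q -> q * delta < 1 ->
  1 <= (1 + delta) `^ q <= (1 - q * delta)^-1.
Proof.
move=> d0 q0 qd; have d1 : 0 < 1 + delta by rewrite ltr_wpDr.
apply/andP; split.
  rewrite -[leLHS](powRr0 (1 + delta)) ler_powR ?(ltW q0)//; lra.
rewrite -[leLHS]invrK lef_pV2 ?posrE ?invr_gt0 ?powR_gt0 ?subr_gt0//.
rewrite -powRN /powR gt_eqF//.
apply: le_trans (expR_ge1Dx _).
rewrite mulNr lerD2l lerN2 ler_pM2l//.
by apply: le_ln1Dx; apply: lt_le_trans d0; rewrite oppr_lt0.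
Qed.

(** As [a] tends to 0, [(1 - a) * ((1 - a * u) / (1 - a)) ^ p] is
[1 - a * (p * u - (p - 1)) + o(a)], so that the last quotient tends to
[N / (p * u - (p - 1)) < C]. Exponential bounds make this quantitative. *)
Lemma geometric_parameter (R : realType) (p u N C : R) :
  1 < p -> 0 < u -> u < 1 -> 0 <= N -> N < C * (p * u - (p - 1)) -> 0 < C ->
  exists a : R, [/\ 0 < a, a < 1,
    (1 - a) * ((1 - a * u) / (1 - a)) `^ p < 1 &
    N * a / (1 - (1 - a) * ((1 - a * u) / (1 - a)) `^ p) < C].
Proof.
move=> p1 u0 u1 N0 NC C0.
set P := p * u - (p - 1) in NC *.
have P0 : 0 < P by rewrite -(pmulr_rgt0 _ C0); apply: le_lt_trans NC.
have p10 : 0 < p - 1 by rewrite subr_gt0.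
have W0 : 0 < N * P + 2 * C * (p - 1).
  by rewrite ltr_wpDl ?mulr_ge0 ?mulr_gt0// ltW.
(* The bound on [a] absorbs the terms of order [a] lost in the expansion. *)
have [a [a0 a12 aW]] : exists a : R,
    [/\ 0 < a, a <= 1 / 2 & a * (N * P + 2 * C * (p - 1)) < C * P - N].
  exists (Num.min (1 / 2) ((C * P - N) / (2 * (N * P + 2 * C * (p - 1))))).
  split.
  - by rewrite lt_min divr_gt0//= divr_gt0 ?subr_gt0// mulr_gt0.
  - by rewrite ge_min lexx.
  - rewrite -ltr_pdivlMr// gt_min; apply/orP; right.
    rewrite invfM mulrA ltr_pM2r ?invr_gt0//.
    rewrite ltr_pdivrMr//; lra.
exists a.
have a1 : a < 1 by lra.
have a1' : 0 < 1 - a by lra.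
have au : a * u < 1 by rewrite -(mul1r 1) ltr_pM// ltW.
have au' : 0 < 1 - a * u by lra.
set y := P - (p - 1) * (a / (1 - a)).
have aa : a / (1 - a) <= 2 * a.
  by rewrite ler_pdivrMr// -[leLHS]mulr1 (mulrC 2) -mulrA ler_pM2l//; lra.
have yW : N * (1 + a * y) < C * y.
  have h1 : P - (p - 1) * (2 * a) <= y by rewrite lerB// ler_pM2l.
  have h2 : y <= P by rewrite lerBlDr lerDl mulr_ge0 ?divr_ge0 ?ltW.
  have h3 := ler_wpM2l N0 (ler_wpM2l (ltW a0) h2).
  have h4 := ler_wpM2l (ltW C0) h1.
  by lra.
have y0 : 0 < y.
  rewrite ltNge; apply/negP => yle.
  have h4 : C * y <= 0 by rewrite pmulr_rle0.
  have h1 : P - (p - 1) * (2 * a) <= y by rewrite lerB// ler_pM2l.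
  have h5 := ler_wpM2l (ltW C0) h1.
  have h6 : 0 <= a * (N * P) by rewrite !mulr_ge0// ltW.
  lra.
set G := (1 - a) * _.
have Gexp : G <= (1 + a * y)^-1.
  have GE : G = expR (p * ln (1 - a * u) + (p - 1) * ln (1 - a)^-1).
    rewrite /G /powR gt_eqF ?divr_gt0// ln_div ?posrE// lnV ?posrE//.
    rewrite -[X in X * _](lnK (x := 1 - a)) ?posrE// -expRD; congr expR; ring.
  have h1 : ln (1 - a * u) <= - (a * u) by apply: le_ln1Dx; lra.
  have h2 : ln (1 - a)^-1 <= a / (1 - a).
    have {1}-> : (1 - a)^-1 = 1 + a / (1 - a) by field; rewrite gt_eqF.
    by apply: le_ln1Dx; apply: lt_trans (ltrN10 _) _; rewrite divr_gt0.
  have h3 := ler_wpM2l (ltW (lt_trans ltr01 p1)) h1.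
  have h4 := ler_wpM2l (ltW p10) h2.
  have le1 : G <= expR (- (a * y)).
    rewrite GE ler_expR; apply: (le_trans (lerD h3 h4)).
    rewrite le_eqVlt; apply/orP; left; apply/eqP; rewrite /y /P.
    by field; rewrite gt_eqF.
  apply: (le_trans le1); rewrite expRN lef_pV2 ?posrE ?expR_gt0 ?expR_ge1Dx//.
  by rewrite ltr_wpDr// ltW// mulr_gt0.
have ay0 : 0 < a * y by rewrite mulr_gt0.
have ay1 : 0 < 1 + a * y by rewrite ltr_wpDr// ltW.
have G1 : a * y / (1 + a * y) <= 1 - G.
  have -> : a * y / (1 + a * y) = 1 - (1 + a * y)^-1 by field; rewrite gt_eqF.
  by rewrite lerB.
have G0 : 0 < 1 - G by apply: lt_le_trans G1; rewrite divr_gt0.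
split => //; first by lra.
rewrite ltr_pdivrMr//; apply: lt_le_trans (ler_wpM2l (ltW C0) G1).
rewrite !mulrA ltr_pdivlMr// -!mulrA (mulrCA N) (mulrCA C) ltr_pM2l//.
Qed.

(** Take [u = u0 * (1 + delta)] with [u0 = 1 / (beta + 1)]. At [u = u0] one has
[K * u ^ q - 1 = C1 * (p * u - (p - 1))] for the critical constant
[C1 = q * (beta + 1) / D], with both sides 0 when [beta = 1 / (p - 1)]. There
the left-hand side has derivative [p * C1], while [C * (p * u - (p - 1))] has
derivative [p * C > p * C1]; hence for small [delta > 0] the hypothesis of
[geometric_parameter] holds, for all admissible [beta] at once. *)
Lemma extremal_parameters (R : realType) (p q beta C : R) :
  1 < p -> 1 <= q -> q <= p -> 0 < beta -> beta <= 1 / (p - 1) ->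
  let D := (p - 1) * q * beta + (p - q) in
  let K := p * (beta + 1) `^ q / D in
  q * (beta + 1) / D < C ->
  exists u a : R, [/\ 0 < u < 1, 0 < a < 1, K * (p - q) / p <= u^-1 `^ q,
    1 <= K * u `^ q &
    (1 - a) * ((1 - a * u) / (1 - a)) `^ p < 1 /\
    (K * u `^ q - 1) * a / (1 - (1 - a) * ((1 - a * u) / (1 - a)) `^ p) < C].
Proof.
move=> p1 q1 qp b0 bp D K CC.
have p0 : 0 < p by lra.
have p10 : 0 < p - 1 by lra.
have q0 : 0 < q by lra.
have bp1 : (p - 1) * beta <= 1 by rewrite mulrC -ler_pdivlMr.
have D0 : 0 < D by rewrite ltr_wpDr ?subr_ge0// !mulr_gt0.
have C00 : 0 < q * (beta + 1) / D by rewrite divr_gt0 ?mulr_gt0// addr_gt0.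
have C0 : 0 < C by apply: lt_trans CC.
have b10 : 0 < beta + 1 by rewrite addr_gt0.
set C1 := q * (beta + 1) / D in CC C00.
have e0 : 0 < 1 - C1 / C by rewrite subr_gt0 ltr_pdivrMr// mul1r.
have DM : 0 < (p - 1) * beta / D by rewrite divr_gt0 ?mulr_gt0.
(* The three bounds on [delta] give in turn [u < 1], the condition
   [K * (p - q) / p <= u^-1 ^ q], and [C1 / (1 - q * delta) < C]. *)
have [delta [d0 d1 d2 d3]] : exists delta : R, [/\ 0 < delta, delta < beta,
    delta <= (p - 1) * beta / D & q * delta < 1 - C1 / C].
  exists (Num.min (beta / 2) (Num.min ((p - 1) * beta / D) ((1 - C1 / C) / (2 * q)))).
  split.
  - by rewrite !lt_min !divr_gt0//= mulr_gt0.
  - by rewrite gt_min; apply/orP; left; rewrite ltr_pdivrMr//; lra.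
  - by rewrite !ge_min lexx orbT.
  - rewrite mulrC -ltr_pdivlMr// !gt_min; apply/orP; right; apply/orP; right.
    rewrite invfM mulrA ltr_pM2r ?invr_gt0// ltr_pdivrMr//; lra.
have qd1 : q * delta < 1.
  by apply: (lt_trans d3); rewrite ltrBlDr ltrDl divr_gt0.
have /andP[t1 t2] := powR_one_add_bounds (ltW d0) q0 qd1.
pose u := (1 + delta) / (beta + 1).
have u0 : 0 < u by rewrite divr_gt0// addr_gt0.
have u1 : u < 1 by rewrite ltr_pdivrMr// mul1r addrC ltrD2r.
have d10 : 0 < 1 + delta by rewrite addr_gt0.
have b1q : 0 < (beta + 1) `^ q by rewrite powR_gt0.
have tq : 0 < (1 + delta) `^ q by rewrite powR_gt0.
have uq : u `^ q = (1 + delta) `^ q / (beta + 1) `^ q.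
  by rewrite /u powRM ?invr_ge0 ?ltW// -powR_inv1 ?ltW// -powRrM mulN1r powRN.
have Kuq : K * u `^ q = p / D * (1 + delta) `^ q.
  by rewrite uq /K; field; rewrite !gt_eqF.
have uVq : u^-1 `^ q = (beta + 1) `^ q / (1 + delta) `^ q.
  by rewrite -powR_inv1 ?ltW// -powRrM mulN1r powRN uq invf_div.
have Dp : D <= p.
  by rewrite /D mulrAC; have := ler_wpM2r (ltW q0) bp1; lra.
have pD1 : 1 <= p / D by rewrite ler_pdivlMr// mul1r.
have K1 : 1 <= K * u `^ q by rewrite Kuq -[leLHS]mulr1 ler_pM.
have qd1' : 0 < 1 - q * delta by rewrite subr_gt0.
have [a [a0 a1 h1 h2]] : exists a : R, [/\ 0 < a, a < 1,
    (1 - a) * ((1 - a * u) / (1 - a)) `^ p < 1 &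
    (K * u `^ q - 1) * a / (1 - (1 - a) * ((1 - a * u) / (1 - a)) `^ p) < C].
  apply: (geometric_parameter p1 u0 u1 _ _ C0); first by rewrite subr_ge0.
  rewrite Kuq.
  have p_D0 : 0 < p / D by rewrite divr_gt0.
  apply: le_lt_trans (_ : p / D * (1 - q * delta)^-1 - 1 < _).
    by rewrite lerB// ler_pM2l.
  set P := (1 - (p - 1) * beta) / (beta + 1).
  have P0 : 0 <= P by rewrite divr_ge0 ?subr_ge0 ?(ltW b10).
  have -> : p * u - (p - 1) = P + p * delta / (beta + 1).
    by rewrite /u /P; field; rewrite gt_eqF.
  have -> : p / D * (1 - q * delta)^-1 - 1 =
      C1 * P + C1 / (1 - q * delta) * (p * delta / (beta + 1)).
    by rewrite /C1 /P /D; field; rewrite !gt_eqF.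
  rewrite mulrDr ler_ltD// ?ler_wpM2r ?(ltW CC)//.
  rewrite ltr_pM2r ?divr_gt0 ?mulr_gt0//.
  rewrite ltr_pdivrMr// -ltr_pdivrMl// mulrC; lra.
exists u, a; split; rewrite ?u0 ?a0//.
rewrite uVq /K.
rewrite ler_pdivlMr//.
have -> : p * (beta + 1) `^ q / D * (p - q) / p * (1 + delta) `^ q =
   (beta + 1) `^ q * ((1 + delta) `^ q * ((p - q) / D)).
  by field; rewrite !gt_eqF.
rewrite -[leRHS]mulr1 ler_pM2l//.
apply: le_trans (_ : (1 - q * delta)^-1 * ((p - q) / D) <= _).
  by rewrite ler_wpM2r ?divr_ge0 ?subr_ge0 ?(ltW D0).
rewrite ler_pdivrMl// mulr1 ler_pdivrMr//.
have := ler_wpM2l (ltW q0) d2; rewrite mulrA ler_pdivlMr// /D; lra.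
Qed.

(** * Combinatorics of trees *)

(** The family may be finite, so the sequence is padded with the empty set, which meets
nothing and therefore preserves disjointness. *)
Lemma countable_family_seq (X : Type) (G : set (set X)) : countable G ->
  exists F : nat -> set X,
    [/\ forall n, F n = set0 \/ G (F n),
        forall I, G I -> exists n, F n = I,
        \bigcup_n F n = \bigcup_(I in G) I &
        trivIset G id -> trivIset setT F].
Proof.
move=> /countable_injP[f finj].
pose F n := \bigcup_(I in G `&` [set I | f I = n]) I.
have FE I : G I -> F (f I) = I.
  move=> GI; apply/seteqP; split=> [x [J [GJ /= fJ] Jx]|x Ix]; last by exists I.
  by rewrite -(finj J I) ?inE.
have FG n : F n = set0 \/ exists I, [/\ G I, f I = n & F n = I].
  have [[I GI fI]|nI] := pselect (exists2 I, G I & f I = n).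
    by right; exists I; split=> //; rewrite -fI FE.
  by left; rewrite -subset0 => x [J [GJ fJ] _]; apply: nI; exists J.
exists F; split.
- by move=> n; have [->|[I [GI _ ->]]] := FG n; [left|right].
- by move=> I GI; exists (f I); rewrite FE.
- apply/seteqP; split=> x; first by move=> [n _ [J [GJ _] Jx]]; exists J.
  by move=> [I GI Ix]; exists (f I) => //; rewrite FE.
- move=> tG i j _ _ [x [[I [GI <-] Ix] [J [GJ <-] Jx]]].
  by congr f; apply: tG => //; exists x.
Qed.

Section tree_combinatorics.
Context {d : measure_display} {X : measurableType d} {R : realType}.
Variables (mu : probability X R) (T : set (set X)) (C : set X -> set (set X)).
Hypothesis treeT : is_tree_with mu T C.
Local Notation level := (tree_level C).

Lemma level_sub m : level m `<=` T.
Proof. by move=> I mI; rewrite (tree_levels treeT); exists m. Qed.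

Lemma tree_countable : countable T.
Proof.
rewrite (tree_levels treeT); apply: bigcup_countable => // m _.
elim: m => [|m IH] /=; first exact: countable1.
apply: bigcup_countable => // I mI.
exact: (tree_children_countable treeT) (level_sub mI).
Qed.

Lemma level_cover m x : exists2 I, level m I & I x.
Proof.
elim: m => [|m [I mI Ix]]; first by exists setT.
move: Ix; rewrite {1}(tree_children_cover treeT (level_sub mI)) => -[J IJ Jx].
by exists J => //; exists I.
Qed.

Lemma level_disjoint m : trivIset (level m) id.
Proof.
elim: m => [|m IH] /=; first by move=> _ _ -> ->.
move=> I J [I' mI' CI] [J' mJ' CJ] [x [Ix Jx]].
have sub := tree_children_subset treeT.
have e : I' = J'.
  apply: IH => //; exists x.
  by split; [exact: sub (level_sub mI') _ CI _ Ix
            |exact: sub (level_sub mJ') _ CJ _ Jx].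
rewrite -e in CJ.
by apply: (tree_children_disjoint treeT (level_sub mI')) => //; exists x.
Qed.

Lemma level_nested m k I K : (m <= k)%N -> level m I -> level k K ->
  I `&` K !=set0 -> K `<=` I.
Proof.
elim: k K => [|k IH] K.
  rewrite leqn0 => /eqP -> mI kK IK.
  by rewrite (level_disjoint mI kK IK).
rewrite leq_eqVlt => /predU1P[->|mk] mI kK IK.
  by rewrite (level_disjoint mI kK IK).
move: kK => [K' kK' CK].
have KK' := tree_children_subset treeT (level_sub kK') CK.
apply: (subset_trans KK'); apply: IH => //.
by case: IK => x [Ix Kx]; exists x; split=> //; exact: KK'.
Qed.

Lemma level_mesh (e : R) : 0 < e ->
  \forall m \near \oo, forall I, level m I -> (mu I < e%:E)%E.
Proof.
move=> e0.
have nb : nbhs (0%E : \bar R) [set y | (y < e%:E)%E].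
  by apply: (@open_ereal_lt' R 0%E e%:E); rewrite lte_fin.
have h : \forall m \near \oo, (ereal_sup [set mu I | I in level m] < e%:E)%E.
  exact: (tree_mesh treeT nb).
apply: filterS h => m hm I mI.
by apply: le_lt_trans hm; apply: ereal_sup_ubound; exists I.
Qed.

(** Cells are nested or disjoint, so two maximal members of [G] are equal or disjoint.
Each point of the union lies in a maximal member: the one of least level among
those that contain the point. *)
Lemma maximal_decomposition (G : set (set X)) : G `<=` T ->
  exists F : nat -> set X,
    [/\ forall n, F n = set0 \/ G (F n), trivIset setT F &
        \bigcup_n F n = \bigcup_(I in G) I].
Proof.
move=> GT.
pose G' := [set I | G I /\ forall J, G J -> I `<=` J -> J = I].
have lev I : G I -> exists m, level m I.
  by move=> /GT; rewrite (tree_levels treeT) => -[m _ mI]; exists m.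
have G'T : G' `<=` T by move=> I [/GT].
have [F [F0 _ FU Ft]] :=
  countable_family_seq (sub_countable (subset_card_le G'T) tree_countable).
exists F; split.
- by move=> n; have [->|[GF _]] := F0 n; [left|right].
- apply: Ft => I J [GI maxI] [GJ maxJ] IJ.
  have [m mI] := lev _ GI; have [k kJ] := lev _ GJ.
  have [mk|/ltnW km] := leqP m k.
    by apply: maxJ => //; exact: level_nested mk mI kJ IJ.
  by apply/esym/maxI => //; apply: level_nested km kJ mI _; rewrite setIC.
- rewrite FU; apply/seteqP; split=> x; first by move=> [I [GI _] Ix]; exists I.
  move=> [I GI Ix].
  pose P m := `[< exists J, [/\ G J, level m J & J x] >].
  have exP : exists m, P m by have [m mI] := lev _ GI; exists m; apply/asboolP; exists I.
  case: (ex_minnP exP) => m /asboolP[J [GJ mJ Jx]] mmin.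
  exists J => //; split=> // K GK JK.
  have [k kK] := lev _ GK.
  have mk : (m <= k)%N by apply: mmin; apply/asboolP; exists K; split=> //; exact: JK.
  apply/seteqP; split=> //; apply: level_nested mk mJ kK _.
  by exists x; split=> //; exact: JK.
Qed.

(** Greedy choice: enumerate the cells inside [I] and add each of them to the union as
long as the measure stays at most [t]. If the final measure fell short of [t], a
point of [I] outside the union would lie in a cell smaller than the remaining gap,
and that cell would have been added at its turn. The chosen cells may overlap,
which is harmless: only their union matters. *)
Lemma tree_subset_of_measure I (t : R) : T I -> 0 <= t -> (t%:E < mu I)%E ->
  exists G, [/\ G `<=` T, forall J, G J -> J `<=` I &
    mu (\bigcup_(J in G) J) = t%:E].
Proof.
move=> TI t0 tI.
have sub0 : [set J | T J /\ J `<=` I] `<=` T by move=> J [].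
have [J [J0 Jall _ _]] :=
  countable_family_seq (sub_countable (subset_card_le sub0) tree_countable).
have mT := tree_measurable treeT.
have mJ n : measurable (J n) by have [->//|[/mT]] := J0 n.
have JI n : J n `<=` I by have [->|[_]] := J0 n; first exact: sub0set.
pose A := fix A n := if n is n'.+1 then
  (if (mu (A n' `|` J n') <= t%:E)%E then A n' `|` J n' else A n') else set0.
have mA n : measurable (A n).
  by elim: n => //= n IH; case: ifP => // _; exact: measurableU.
have At n : (mu (A n) <= t%:E)%E.
  by elim: n => [|n IH] /=; [rewrite measure0 lee_fin|case: ifP].
have ndA : nondecreasing_seq A.
  apply/nondecreasing_seqP => n; apply/subsetPset => /=.
  by case: ifP => _; [exact: subsetUl|exact: subset_refl].
pose G := [set K | T K /\ exists n, K = J n /\ (mu (A n `|` J n) <= t%:E)%E].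
have GA : \bigcup_(K in G) K = \bigcup_n A n.
  apply/seteqP; split=> x.
    by move=> [_ [_ [n [-> h]]] Jx]; exists n.+1 => //=; rewrite h; right.
  move=> [n _]; elim: n => [|n IH] //=; case: ifP => // h [//|Jx].
  exists (J n) => //; have [J00|[TJ _]] := J0 n; first by rewrite J00 in Jx.
  by split=> //; exists n.
have mUA : measurable (\bigcup_n A n) by exact: bigcupT_measurable.
have AI : \bigcup_n A n `<=` I.
  by rewrite -GA => x [_ [_ [n [-> _]]] /JI].
exists G; split; [by move=> K []|by move=> _ [_ [n [-> _]]]|].
rewrite GA; apply/eqP; rewrite eq_le; apply/andP; split.
  have cA := nondecreasing_cvg_mu mA mUA ndA.
  exact: (cvge_le (nearW _ At) (cA _ mu)).
rewrite leNgt; apply/negP => At'.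
have fA : mu (\bigcup_n A n) \is a fin_num by exact: fin_num_measure.
pose e := t - fine (mu (\bigcup_n A n)).
have e0 : 0 < e by rewrite subr_gt0 -lte_fin fineK.
have [x [Ix nAx]] : (I `\` \bigcup_n A n) !=set0.
  apply/set0P/negP => /eqP; rewrite setD_eq0 => IA.
  by have := lt_trans At' tI; rewrite ltNge le_measure ?inE//; exact: mT.
have := TI; rewrite (tree_levels treeT) => -[m0 _ m0I].
have [m [mm0 mm]] : exists m, (m0 <= m)%N /\ forall I, level m I -> (mu I < e%:E)%E.
  have [N _ hN] := level_mesh e0.
  by exists (maxn m0 N); split; [exact: leq_maxl|exact: hN (leq_maxr _ _)].
have [K mK Kx] := level_cover m x.
have KI : K `<=` I by apply: level_nested mm0 m0I mK _; exists x.
have [n nK] : exists n, J n = K by apply: Jall; split=> //; exact: level_sub mK.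
apply: nAx; exists n.+1 => //=.
have -> : (mu (A n `|` J n) <= t%:E)%E.
  apply: (@le_trans _ _ (mu (A n) + mu (J n))%E).
    exact: measureU2.
  have -> : t%:E = (mu (\bigcup_n A n) + e%:E)%E.
    by rewrite -[X in (X + _)%E](fineK fA) -EFinD /e addrC subrK.
  apply: leeD; last by rewrite nK; apply/ltW/mm.
  by apply: le_measure; rewrite ?inE//; exact: bigcup_sup.
by right; rewrite nK.
Qed.

End tree_combinatorics.

(** * Sparse families and geometric functions *)

Section sparse.
Context {d : measure_display} {X : measurableType d} {R : realType}.
Variables (mu : probability X R) (T : set (set X)) (C : set X -> set (set X)).
Hypothesis treeT : is_tree_with mu T C.

Lemma sparse_refinement (F : nat -> set X) (theta : R) :
  0 < theta -> theta < 1 ->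
  (forall n, F n = set0 \/ T (F n)) -> trivIset setT F ->
  exists F' : nat -> set X, [/\ forall n, F' n = set0 \/ T (F' n), trivIset setT F',
    forall n, exists k, F' n `<=` F k &
    forall k, mu (F k `&` \bigcup_n F' n) = (theta%:E * mu (F k))%E].
Proof.
move=> theta0 theta1 F0 Ft.
have hG k : exists G : set (set X), [/\ G `<=` T, forall J, G J -> J `<=` F k &
    mu (\bigcup_(J in G) J) = (theta%:E * mu (F k))%E].
  have [->|TF] := F0 k.
    by exists set0; split=> //; rewrite bigcup_set0 measure0 mule0.
  have fF : mu (F k) \is a fin_num.
    by apply: fin_num_measure; exact: tree_measurable treeT _ TF.
  have F_gt0 : 0 < fine (mu (F k)).
    by rewrite -lte_fin fineK//; exact: tree_pos treeT _ TF.
  have [||G [GT GF muG]] := @tree_subset_of_measure _ _ _ mu T C treeT (F k)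
      (theta * fine (mu (F k))) TF.
  - by rewrite mulr_ge0// ltW.
  - by rewrite -[ltRHS]fineK// lte_fin gtr_pMl.
  by exists G; split=> //; rewrite muG EFinM fineK.
have {hG}[G hG] := choice hG.
have GT : \bigcup_k G k `<=` T by move=> J [k _ GJ]; have [+ _ _] := hG k; exact.
have [F' [F'0 F't F'U]] := maximal_decomposition treeT GT.
exists F'; split=> //.
- by move=> n; have [->|/GT] := F'0 n; [left|right].
- move=> n; have [->|[k _ GF]] := F'0 n; first by exists 0%N.
  by exists k; have [_ + _] := hG k; exact.
- move=> k; have [_ GF <-] := hG k; congr (mu _); rewrite F'U.
  apply/seteqP; split=> x.
    move=> [Fx [J [k' _ GJ] Jx]]; exists J => //.
    have [_ GF' _] := hG k'.
    suff -> : k = k' by [].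
    by apply: Ft => //; exists x; split=> //; exact: GF' Jx.
  by move=> [J GJ Jx]; split; [exact: GF Jx|exists J => //; exists k].
Qed.

(** Iterating [sparse_refinement] from the root. The self-similarity in the last
clause follows by induction on [j]: a cell of the [(m + j)]-th family is either
inside the cell [S m k] or disjoint from it, so the proportion [theta] lost by
each of them is also lost by their union inside [S m k]. *)
Lemma sparse_families (theta : R) : 0 < theta -> theta < 1 ->
  exists S : nat -> nat -> set X,
    let E m := \bigcup_n S m n in
    [/\ S 0 0 = setT, forall m n, S m n = set0 \/ T (S m n),
      forall m, E m.+1 `<=` E m &
      forall m j k, mu (S m k `&` E (m + j)%N) = ((theta ^+ j)%:E * mu (S m k))%E].
Proof.
move=> theta0 theta1.
pose P (F : nat -> set X) := (forall n, F n = set0 \/ T (F n)) /\ trivIset setT F.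
have step (F : nat -> set X) : exists F' : nat -> set X, P F -> [/\ P F',
    forall n, exists k, F' n `<=` F k &
    forall k, mu (F k `&` \bigcup_n F' n) = (theta%:E * mu (F k))%E].
  have [[F0 Ft]|nP] := pselect (P F); last by exists F => /nP.
  have [F' [? ? ? ?]] := sparse_refinement theta0 theta1 F0 Ft.
  by exists F' => _; split.
have {step}[g hg] := choice step.
pose F0 n := if n is 0 then [set: X] else set0.
pose S m := iter m g F0.
have PS m : P (S m).
  elim: m => [|m IH]; last by have [] := hg _ IH.
  split; first by case=> [|n]; [right; exact: tree_root treeT|left].
  by move=> [|i] [|j] _ _ //= [x []].
have mS m n : measurable (S m n).
  by have [/(_ n)[->//|TS] _] := PS m; exact: tree_measurable treeT _ TS.
(* Cells of later families refine those of earlier ones. *)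
have refine m j n : exists k, S (m + j)%N n `<=` S m k.
  elim: j n => [|j IH] n; first by exists n; rewrite addn0.
  rewrite addnS; have [_ /(_ n)[k sk] _] := hg _ (PS (m + j)%N).
  by have [k' sk'] := IH k; exists k'; exact: subset_trans sk sk'.
have mE m : measurable (\bigcup_n S m n) by exact: bigcupT_measurable.
have subE m : \bigcup_n S m.+1 n `<=` \bigcup_n S m n.
  move=> x [n _ Sx]; have [k sk] := refine m 1%N n.
  by exists k => //; apply: sk; rewrite addn1.
exists S; split=> //; first by move=> m n; have [+ _] := PS m; exact.
move=> m j k; elim: j => [|j IH].
  rewrite addn0 expr0 mul1e; congr (mu _); apply/seteqP; split=> x; first by case.
  by move=> Sx; split=> //; exists k.
rewrite addnS exprS EFinM -muleA -IH.
set I := S m k; set n := (m + j)%N.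
have mI : measurable I := mS m k.
have mIE i : measurable (I `&` \bigcup_l S i l) by exact: measurableI.
have nestI i : S n i `<=` I \/ S n i `&` I = set0.
  have [k' sk'] := refine m j i.
  have [e|kk'] := pselect (k' = k); first by left; rewrite /I -e.
  right; rewrite -subset0 => x [Sx Ix]; apply: kk'.
  by have [_ tS] := PS m; apply: tS => //; exists x; split=> //; exact: sk'.
have partE (A : set X) : measurable A -> A `<=` \bigcup_i S n i ->
    mu A = (\sum_(i <oo) mu (S n i `&` A))%E.
  move=> mA AE; rewrite -measure_semi_bigcup.
  - by rewrite -setI_bigcupl setIidr.
  - by move=> i; exact: measurableI.
  - by apply: trivIset_setIr; have [] := PS n.
  - by rewrite -setI_bigcupl; exact: measurableI.
rewrite partE; [|exact: mIE|by move=> x [_ /subE]].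
rewrite [in RHS]partE; [|exact: mIE|by move=> x []].
rewrite -nneseriesZl//; apply: eq_eseriesr => i _.
have [SI|SI0] := nestI i.
  have [_ _ /(_ i) /= h] := hg _ (PS n).
  rewrite setIA (setIidl SI) h; congr (_ * mu _)%E.
  apply/seteqP; split=> x; last by case.
  by move=> Sx; split=> //; split; [exact: SI|exists i].
by rewrite !setIA SI0 !set0I measure0 mule0.
Qed.

End sparse.

Section geometric_step.
Context {d : measure_display} {X : measurableType d} {R : realType}.
Variable (mu : probability X R).

(** For pairwise disjoint [D n], the function equal to [b ^ n] on [D n] and to 0 off
their union. The form of a series makes measurability and integration termwise. *)
Definition geometric_step (D : nat -> set X) (b : R) (x : X) : \bar R :=
  (\sum_(n <oo) (b ^+ n * \1_(D n) x)%:E)%E.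

Lemma geometric_step_in (D : nat -> set X) (b : R) n x :
  0 <= b -> trivIset setT D -> D n x ->
  geometric_step D b x = (b ^+ n)%:E.
Proof.
move=> b0 tD Dx; rewrite /geometric_step (@nneseriesD1 _ _ n)//; last first.
  by move=> k _; rewrite lee_fin mulr_ge0 ?exprn_ge0.
rewrite eseries0 ?adde0; first by rewrite indicE mem_set// mulr1.
move=> i _ ni; rewrite indicE memNset ?mulr0// => Dix.
by move/eqP: ni; apply; apply: tD => //; exists x.
Qed.

Lemma geometric_step_out (D : nat -> set X) (b : R) x :
  (forall n, ~ D n x) -> geometric_step D b x = 0%E.
Proof.
by move=> nD; apply: eseries0 => i _ _; rewrite indicE memNset ?mulr0.
Qed.

Lemma measurable_geometric_step (D : nat -> set X) (b : R) :
  0 <= b -> (forall n, measurable (D n)) ->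
  measurable_fun setT (geometric_step D b).
Proof.
move=> b0 mD; apply: ge0_emeasurable_sum => [k x _ _|k _].
  by rewrite lee_fin mulr_ge0 ?exprn_ge0.
by apply/measurable_EFinP; apply: measurable_funM => //; exact: measurable_indic.
Qed.

Lemma integral_geometric_step (E : nat -> set X) (I : set X) (m : nat) (theta b : R) :
  let D n := E n `\` E n.+1 in
  (forall n, measurable (E n)) -> measurable I -> 0 < theta -> theta < 1 ->
  0 < b -> b * theta < 1 ->
  (forall n, E n.+1 `<=` E n) -> I `<=` E m ->
  (forall j, mu (I `&` E (m + j)%N) = ((theta ^+ j)%:E * mu I)%E) ->
  (\int[mu]_(x in I) geometric_step D b x =
    (b ^+ m * ((1 - theta) / (1 - b * theta)))%:E * mu I)%E.
Proof.
move=> D mE mI t0 t1 b0 bt Edec IE muIE.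
have mD n : measurable (D n) by exact: measurableD.
have fI : mu I \is a fin_num by exact: fin_num_measure.
have mf n : measurable_fun I (fun x => (b ^+ n * \1_(D n) x)%:E).
  by apply/measurable_EFinP; apply: measurable_funM => //; exact: measurable_indic.
have f0 n x : I x -> (0 <= (b ^+ n * \1_(D n) x)%:E)%E.
  by move=> _; rewrite lee_fin mulr_ge0// exprn_ge0// ltW.
rewrite (integral_nneseries mu mI mf f0).
have int1 n :
    (\int[mu]_(x in I) (b ^+ n * \1_(D n) x)%:E = (b ^+ n)%:E * mu (D n `&` I))%E.
  under eq_integral do rewrite EFinM.
  rewrite ge0_integralZl ?integral_indic//.
  - by apply/measurable_EFinP; exact: measurable_indic.
  - by rewrite lee_fin exprn_ge0// ltW.
under eq_eseriesr do rewrite int1.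
rewrite (@nneseries_split _ _ 0%N m); last first.
  by move=> k _; rewrite mule_ge0// lee_fin exprn_ge0// ltW.
have Emono i j : (i <= j)%N -> E j `<=` E i.
  move=> /subnKC <-; elim: (j - i)%N => [|k IH]; first by rewrite addn0.
  by rewrite addnS; exact: subset_trans IH.
rewrite big1_seq ?add0e; last first.
  move=> i /=; rewrite mem_index_iota add0n => im.
  rewrite (_ : D i `&` I = set0) ?measure0 ?mule0//.
  by rewrite -subset0 => x [[_ nE] Ix]; exact/nE/(Emono _ _ im)/IE.
rewrite add0n.
have muD j : mu (D (m + j)%N `&` I) = ((theta ^+ j * (1 - theta))%:E * mu I)%E.
  rewrite (_ : D _ `&` I = (I `&` E (m + j)%N) `\` (I `&` E (m + j).+1)); last first.
    apply/seteqP; split=> x.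
      by move=> [[Ex nEx] Ix]; split=> // -[].
    by move=> [[Ix Ex] nEx]; split=> //; split=> // Ex'; apply: nEx.
  have sub : (I `&` E (m + j)%N) `&` (I `&` E (m + j).+1) = I `&` E (m + j.+1)%N.
    rewrite addnS; apply/seteqP; split=> x; first by case.
    by move=> [Ix Ex]; split=> //; split=> //; exact: Edec.
  transitivity (mu (I `&` E (m + j)%N) - mu (I `&` E (m + j.+1)%N))%E.
    rewrite -sub measureD//; [exact: measurableI|exact: measurableI|].
    by rewrite -ge0_fin_numE//; apply: fin_num_measure; exact: measurableI.
  by rewrite !muIE -(fineK fI) -!EFinM -EFinB; congr EFin; rewrite exprS; ring.
have -> : (\sum_(m <= k <oo) (b ^+ k)%:E * mu (D k `&` I) =
   \sum_(k <oo) ((b ^+ m * (1 - theta) * fine (mu I)) * (b * theta) ^+ k)%:E)%E.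
  rewrite -nneseries_addn; last first.
    by move=> k; rewrite mule_ge0// lee_fin exprn_ge0// ltW.
  apply: eq_eseriesr => k _; rewrite addnC muD -(fineK fI) -!EFinM; congr EFin.
  by rewrite exprD exprMn /=; ring.
have bt0 : `|b * theta| < 1 by rewrite ger0_norm// ltW// mulr_gt0.
have := @cvg_geometric_series _ (b ^+ m * (1 - theta) * fine (mu I)) _ bt0.
move=> cs; apply/cvg_lim => //.
have -> : ((b ^+ m * ((1 - theta) / (1 - b * theta)))%:E * mu I)%E =
    (b ^+ m * (1 - theta) * fine (mu I) / (1 - b * theta))%:E.
  by rewrite -[in LHS](fineK fI) -EFinM; congr EFin; ring.
under eq_fun do rewrite sumEFin.
apply: cvg_EFin; first exact: nearW.
exact: cs.
Qed.

End geometric_step.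

(** * A function dominated by its maximal function *)

Section averages.
Context {d : measure_display} {X : measurableType d} {R : realType}.
Variables (mu : probability X R) (T : set (set X)) (C : set X -> set (set X)).
Hypothesis treeT : is_tree_with mu T C.

Lemma tree_measureE I : T I ->
  0 < fine (mu I) /\ mu I = (fine (mu I))%:E.
Proof.
move=> TI; have fI : mu I \is a fin_num.
  by apply: fin_num_measure; exact: tree_measurable treeT _ TI.
by split; [rewrite -lte_fin fineK//; exact: tree_pos treeT _ TI|rewrite fineK].
Qed.

(** Cells have finite positive measure, so the extended-real inverse in the maximal
operator is a real one. *)
Lemma tree_averageE I (e : \bar R) : T I ->
  ((mu I)^-1 * e = ((fine (mu I))^-1)%:E * e)%E.
Proof.
move=> TI; have [I0 IE] := tree_measureE TI.
by rewrite {1}IE inver gt_eqF.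
Qed.

(** The function is [A * gam ^ n] on [E_n \ E_(n+1)], where [E_n] is the union of the
[n]-th family of [sparse_families]. A point of [E_n \ E_(n+1)] lies in a cell of
that family, and the average over that cell, a geometric series, is the stated
multiple of [A * gam ^ n]. *)
Lemma extremal_function (theta gam p A : R) :
  0 < theta -> theta < 1 -> 0 < gam -> gam * theta < 1 ->
  0 < p -> gam `^ p * theta < 1 -> 0 <= A ->
  exists phi : X -> R, [/\ measurable_fun setT phi, forall x, 0 <= phi x,
    (\int[mu]_x (phi x)%:E = (A * ((1 - theta) / (1 - gam * theta)))%:E)%E,
    (\int[mu]_x ((phi x)%:E `^ p) =
      (A `^ p * ((1 - theta) / (1 - gam `^ p * theta)))%:E)%E &
    forall x, (((1 - theta) / (1 - gam * theta) * phi x)%:E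
      <= tree_maximal mu T phi x)%E].
Proof.
move=> t0 t1 g0 gt1 p0 gpt A0.
have [S [S00 ST Edec muE]] := sparse_families treeT t0 t1.
set E := fun m => \bigcup_n S m n in Edec muE *.
pose D n := E n `\` E n.+1.
have mE n : measurable (E n).
  apply: bigcupT_measurable => k; have [->//|TS] := ST n k.
  exact: tree_measurable treeT _ TS.
have mD n : measurable (D n) by exact: measurableD.
have Emono i j : (i <= j)%N -> E j `<=` E i.
  move=> /subnKC <-; elim: (j - i)%N => [|k IH]; first by rewrite addn0.
  by rewrite addnS; exact: subset_trans (Edec _) IH.
have tD : trivIset setT D.
  move=> i j _ _ [x [[Ei nEi] [Ej nEj]]].
  have [ij|ji|//] := ltngtP i j.
    by exfalso; apply/nEi/(Emono _ _ ij).
  by exfalso; apply/nEj/(Emono _ _ ji).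
have cases x : (exists n, D n x) \/ forall n, ~ D n x.
  by have [?|/forallNP ?] := pselect (exists n, D n x); [left|right].
have fin_step (b : R) x : 0 <= b -> geometric_step D b x \is a fin_num.
  move=> b0; have [[n Dn]|nD] := cases x; last by rewrite geometric_step_out.
  by rewrite (geometric_step_in b0 tD Dn).
pose phi x := A * fine (geometric_step D gam x).
have gp0 : 0 < gam `^ p by rewrite powR_gt0.
have phiE x : (phi x)%:E = (A%:E * geometric_step D gam x)%E.
  by rewrite /phi EFinM fineK//; exact/fin_step/ltW.
have phipE x : ((phi x)%:E `^ p = (A `^ p)%:E * geometric_step D (gam `^ p) x)%E.
  rewrite phiE; have [[n Dn]|nD] := cases x.
    rewrite (geometric_step_in (ltW g0) tD Dn) (geometric_step_in (ltW gp0) tD Dn).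
    rewrite -!EFinM poweR_EFin powRM ?exprn_ge0 ?(ltW g0)//.
    by rewrite -!powR_mulrn ?powR_ge0 ?(ltW g0)// powRAC.
  by rewrite !geometric_step_out// !mule0 poweR0r// gt_eqF.
have mstep (b : R) : 0 <= b -> measurable_fun [set: X] (geometric_step D b).
  by move=> b0; exact: measurable_geometric_step.
have step0 (b : R) x : 0 <= b -> (0 <= geometric_step D b x)%E.
  by move=> b0; apply: nneseries_ge0 => n _ _; rewrite lee_fin mulr_ge0 ?exprn_ge0.
have phi0 x : 0 <= phi x by exact: mulr_ge0 A0 (fine_ge0 (step0 _ _ (ltW g0))).
have mphi : measurable_fun setT phi.
  apply/measurable_EFinP;
  rewrite (_ : _ \o _ = fun x => (A%:E * geometric_step D gam x)%E).
    by apply: measurable_funeM; apply: mstep; exact: ltW.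
  by apply/funext => x /=; exact: phiE.
have int_step (b : R) m k : 0 < b -> b * theta < 1 -> measurable (S m k) ->
    (\int[mu]_(x in S m k) geometric_step D b x =
    (b ^+ m * ((1 - theta) / (1 - b * theta)))%:E * mu (S m k))%E.
  move=> b0 bt mS; apply: (integral_geometric_step mE mS t0 t1 b0 bt Edec) => [x Sx|j].
    by exists k.
  exact: muE.
have int_stepT (c : R) : 0 < c -> c * theta < 1 ->
    (\int[mu]_x geometric_step D c x = ((1 - theta) / (1 - c * theta))%:E)%E.
  move=> c0 ct; have := @int_step c 0%N 0%N c0 ct.
  by rewrite S00 => ->//; rewrite probability_setT mule1 expr0 mul1r.
exists phi; split=> //.
- under eq_integral do rewrite phiE.
  rewrite ge0_integralZl//; [|exact/mstep/ltW|by move=> x _; exact/step0/ltW].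
  by rewrite int_stepT// -EFinM.
- under eq_integral do rewrite phipE.
  rewrite ge0_integralZl//; [|exact/mstep/ltW|by move=> x _; exact/step0/ltW|].
    by rewrite int_stepT// -EFinM.
  by rewrite lee_fin powR_ge0.
- move=> x; have [[n Dn]|nD] := cases x; last first.
    rewrite /phi geometric_step_out//= !mulr0.
    apply: (@le_trans _ _ ((mu setT)^-1 * \int[mu]_y `|phi y|%:E)%E); last first.
      by apply: ereal_sup_ubound; exists setT => //; split=> //; exact: tree_root treeT.
    rewrite probability_setT inve1 mul1e; apply: integral_ge0 => y _.
    by rewrite lee_fin.
  have [[k _ Sx] _] := Dn.
  have TS : T (S n k) by have [S0|//] := ST n k; rewrite S0 in Sx.
  have mS : measurable (S n k) by exact: tree_measurable treeT _ TS.
  apply: (@le_trans _ _ ((mu (S n k))^-1 * \int[mu]_(y in S n k) `|phi y|%:E)%E);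
    last by apply: ereal_sup_ubound; exists (S n k).
  rewrite tree_averageE//; have [I0 IE] := tree_measureE TS.
  have -> : (\int[mu]_(y in S n k) `|phi y|%:E =
      A%:E * \int[mu]_(y in S n k) geometric_step D gam y)%E.
    under eq_integral do rewrite ger0_norm// phiE.
    rewrite ge0_integralZl//.
      by apply: measurable_funTS; exact/mstep/ltW.
    by move=> y _; exact/step0/ltW.
  rewrite int_step// IE -!EFinM lee_fin /phi (geometric_step_in (ltW g0) tD Dn) /=.
  rewrite le_eqVlt; apply/orP; left; apply/eqP; field.
  by rewrite (gt_eqF I0) gt_eqF// subr_gt0.
Qed.

End averages.

(** * The maximal inequality *)

Section nonneg_real_integrals.
Context {d : measure_display} {X : measurableType d} {R : realType}.
Variables (mu : {measure set X -> \bar R}) (A : set X).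
Hypothesis mA : measurable A.
Implicit Types (c : R) (g h : X -> R).

Lemma integralZ_ge0 c h : 0 <= c -> measurable_fun A h -> (forall x, 0 <= h x) ->
  (\int[mu]_(x in A) (c * h x)%:E = c%:E * \int[mu]_(x in A) (h x)%:E)%E.
Proof.
move=> c0 mh h0; rewrite -ge0_integralZl//.
- exact/measurable_EFinP.
- by move=> x _; rewrite lee_fin.
Qed.

Lemma integralD_ge0 g h : measurable_fun A g -> measurable_fun A h ->
  (forall x, 0 <= g x) -> (forall x, 0 <= h x) ->
  (\int[mu]_(x in A) (g x + h x)%:E =
   \int[mu]_(x in A) (g x)%:E + \int[mu]_(x in A) (h x)%:E)%E.
Proof.
move=> mg mh g0 h0; rewrite -ge0_integralD//.
- by move=> x _; rewrite lee_fin.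
- exact/measurable_EFinP.
- by move=> x _; rewrite lee_fin.
- exact/measurable_EFinP.
Qed.

Lemma integral_le_ge0 g h : measurable_fun A g -> measurable_fun A h ->
  (forall x, 0 <= g x) -> (forall x, g x <= h x) ->
  (\int[mu]_(x in A) (g x)%:E <= \int[mu]_(x in A) (h x)%:E)%E.
Proof.
move=> mg mh g0 gh; apply: ge0_le_integral => //.
- by move=> x _; rewrite lee_fin.
- exact/measurable_EFinP.
- exact/measurable_EFinP.
- by move=> x _; rewrite lee_fin.
Qed.

End nonneg_real_integrals.

Section levels.
Context {d : measure_display} {X : measurableType d} {R : realType}.
Variables (mu : probability X R) (T : set (set X)) (C : set X -> set (set X)).
Hypothesis treeT : is_tree_with mu T C.
Local Notation level := (tree_level C).

Definition level_cell (m : nat) (x : X) : set X :=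
  xget setT [set I | level m I /\ I x].

Lemma level_cellP m x : level m (level_cell m x) /\ level_cell m x x.
Proof.
have [I mI Ix] := level_cover treeT m x.
exact: (@xgetI _ setT [set I | level m I /\ I x] I).
Qed.

Lemma level_cellE m x I : level m I -> I x -> level_cell m x = I.
Proof.
move=> mI Ix; have [mc cx] := level_cellP m x.
by apply: (level_disjoint treeT mc mI); exists x.
Qed.

Lemma tree_level_cell m x : T (level_cell m x).
Proof. by have [/(level_sub treeT)] := level_cellP m x. Qed.

(** Measurability with respect to the partition into cells of level [m]. *)
Definition level_constant (m : nat) (U : Type) (g : X -> U) :=
  forall x y, level_cell m x = level_cell m y -> g x = g y.

Lemma level_constantW m k U (g : X -> U) : (m <= k)%N ->
  level_constant m g -> level_constant k g.
Proof.
move=> mk gm x y exy; apply: gm.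
have [mc cx] := level_cellP m x; have [kc kx] := level_cellP k x.
apply/esym/level_cellE => //.
apply: (level_nested treeT mk mc kc); first by exists x.
by rewrite exy; have [] := level_cellP k y.
Qed.

Lemma level_partition m : exists F : nat -> set X,
  [/\ forall n, measurable (F n), trivIset setT F, \bigcup_n F n = setT &
    forall n, F n = set0 \/ (T (F n) /\
      forall x, F n x -> level_cell m x = F n)].
Proof.
have sub : level m `<=` T by move=> I; exact: (level_sub treeT).
have cl := sub_countable (subset_card_le sub) (tree_countable treeT).
have [F [F0 _ FU Ft]] := countable_family_seq cl.
exists F; split.
- move=> n; have [->//|/sub] := F0 n; exact: (tree_measurable treeT).
- exact/Ft/(level_disjoint treeT).
- rewrite FU; apply/seteqP; split=> // x _.
  by have [I mI Ix] := level_cover treeT m x; exists I.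
- move=> n; have [->|mF] := F0 n; [by left|right; split; [exact: sub|]].
  by move=> x Fx; rewrite (level_cellE mF).
Qed.

Lemma measurable_level_constant m d' (U : measurableType d') (g : X -> U) :
  level_constant m g -> measurable_fun setT g.
Proof.
move=> gm _ Y mY; rewrite setTI.
have [F [mF _ FU Fm]] := level_partition m.
rewrite (_ : g @^-1` Y = \bigcup_(n in [set n | F n `<=` g @^-1` Y]) F n).
  by apply: bigcup_measurable => n _.
apply/seteqP; split=> x /=; last by move=> [n]; apply.
move=> Yx; have : [set: X] x by []; rewrite -FU => -[n _ Fx].
exists n => // y Fy /=; have [F0|[_ Fc]] := Fm n; first by rewrite F0 in Fx.
by rewrite (gm y x)// !Fc.
Qed.

Variables (phi : X -> R) (f : R).
Hypotheses (mphi : measurable_fun setT phi) (phi0 : forall x, 0 <= phi x)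
  (phif : (\int[mu]_x (phi x)%:E = f%:E)%E).

Definition level_average (m : nat) (x : X) : R :=
  (fine (mu (level_cell m x)))^-1 * fine (\int[mu]_(y in level_cell m x) (phi y)%:E)%E.

Lemma integral_tree_fin I : T I -> (\int[mu]_(y in I) (phi y)%:E)%E \is a fin_num.
Proof.
move=> TI; have mI := tree_measurable treeT TI.
rewrite ge0_fin_numE; last by apply: integral_ge0 => y _; rewrite lee_fin.
apply: (@le_lt_trans _ _ (\int[mu]_x (phi x)%:E)%E); last by rewrite phif ltry.
apply: ge0_subset_integral => //; first exact/measurable_EFinP.
by move=> x _; rewrite lee_fin.
Qed.

Lemma level_average_ge0 m x : 0 <= level_average m x.
Proof.
rewrite mulr_ge0 ?invr_ge0 ?fine_ge0//.
by apply: integral_ge0 => y _; rewrite lee_fin.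
Qed.

Lemma level_average0 x : level_average 0 x = f.
Proof.
rewrite /level_average (@level_cellE 0%N x setT)// probability_setT phif.
by rewrite /= invr1 mul1r.
Qed.

Lemma level_average_cst m : level_constant m (level_average m).
Proof. by move=> x y e; rewrite /level_average e. Qed.

(** The level-[m] average is the conditional expectation of [phi] on the partition
into cells of level [m]. *)
Lemma integral_level_average m (g : X -> R) : (forall x, 0 <= g x) ->
  level_constant m g ->
  (\int[mu]_x (level_average m x * g x)%:E = \int[mu]_x (phi x * g x)%:E)%E.
Proof.
move=> g0 gm; have mg := measurable_level_constant gm.
have ms := measurable_level_constant (@level_average_cst m).
have [F [mF tF FU Fm]] := level_partition m.
have split_cells (h : X -> R) : measurable_fun setT h -> (forall x, 0 <= h x) ->
    (\int[mu]_x (h x)%:E = \sum_(n <oo) \int[mu]_(x in F n) (h x)%:E)%E.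
  move=> mh h0; rewrite -FU; apply: ge0_integral_bigcup => //.
    by rewrite FU; exact/measurable_EFinP.
  by move=> x _; rewrite lee_fin.
rewrite !split_cells; last 4 first.
- exact: measurable_funM.
- by move=> x; rewrite mulr_ge0.
- exact: measurable_funM.
- by move=> x; rewrite mulr_ge0// level_average_ge0.
apply: eq_eseriesr => n _; have [->|[TF Fc]] := Fm n.
  by rewrite !integral_set0.
have [x0 Fx0] : F n !=set0.
  apply/set0P/negP => /eqP F0; have := tree_pos treeT TF.
  by rewrite F0 measure0 ltxx.
have [I0 IE] := tree_measureE treeT TF.
pose c := level_average m x0 * g x0.
have fI := integral_tree_fin TF.
transitivity (\int[mu]_(x in F n) (cst c%:E) x)%E.
  apply: eq_integral => x; rewrite inE => Fx.
  have exx0 : level_cell m x = level_cell m x0 by rewrite !Fc.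
  by rewrite (gm _ _ exx0) (level_average_cst exx0).
transitivity (c%:E * mu (F n))%E; first exact: (integral_cst mu (mF n)).
transitivity (\int[mu]_(x in F n) (g x0 * phi x)%:E)%E; last first.
  apply: eq_integral => x; rewrite inE => Fx.
  by rewrite mulrC (gm x0 x)// !Fc.
rewrite integralZ_ge0//; last exact: measurable_funTS.
rewrite -(fineK fI) IE -!EFinM; congr EFin.
by rewrite /c /level_average Fc//; field; rewrite gt_eqF.
Qed.

Fixpoint running_max (m : nat) (x : X) : R :=
  if m is k.+1 then Num.max (running_max k x) (level_average m x)
  else level_average 0 x.

Definition capped_max (m : nat) (N : R) (x : X) : R := Num.min (running_max m x) N.

Lemma running_max_ge0 m x : 0 <= running_max m x.
Proof.
by elim: m => [|m IH] /=; rewrite ?le_max ?IH// level_average_ge0.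
Qed.

Lemma running_max_cst m : level_constant m (running_max m).
Proof.
elim: m => [|m IH] x y e /=; first exact: level_average_cst.
by rewrite (level_constantW (leqnSn m) IH e) (level_average_cst e).
Qed.

Lemma capped_max_cst m N : level_constant m (capped_max m N).
Proof. by move=> x y /running_max_cst e; rewrite /capped_max e. Qed.

Lemma mean_ge0 : 0 <= f.
Proof. by rewrite -lee_fin -phif; apply: integral_ge0 => x _; rewrite lee_fin. Qed.

Lemma capped_max_ge0 m N x : 0 <= N -> 0 <= capped_max m N x.
Proof. by move=> N0; rewrite le_min running_max_ge0. Qed.

(** Either the running maximum does not move, and both increments vanish, or the new
average is the new running maximum and [powR_sub_le] applies. The cap only lowers
the new value below that average. *)
Lemma capped_maxS_le (p N : R) m x : 1 < p -> 0 <= N ->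
  capped_max m.+1 N x `^ p <= capped_max m N x `^ p +
   p / (p - 1) * (level_average m.+1 x *
     (capped_max m.+1 N x `^ (p - 1) - capped_max m N x `^ (p - 1))).
Proof.
move=> p1 N0; rewrite -lerBlDl.
have [ms|sm] := leP (level_average m.+1 x) (running_max m x).
  have -> : capped_max m.+1 N x = capped_max m N x.
    by rewrite /capped_max /= (max_idPl ms).
  by rewrite !subrr !mulr0.
apply: powR_sub_le => //; first exact: capped_max_ge0.
  by rewrite le_min !ge_min lexx orbT le_max lexx.
by rewrite ge_min /= (max_idPr (ltW sm)) lexx.
Qed.

Lemma measurable_capped_max m N : measurable_fun setT (capped_max m N).
Proof. exact: measurable_level_constant (@capped_max_cst m N). Qed.

(** The inequality of the theorem for [q = 1], by induction on the level. It is
written with nonnegative terms on both sides, so that the induction step is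
additive in the extended reals. At level 0 the capped maximum is the constant
[f] and equality holds. *)
Lemma capped_max_linear (p N : R) m : 1 < p -> f <= N ->
  (\int[mu]_x (capped_max m N x `^ p)%:E + (f `^ p / (p - 1))%:E <=
   (p / (p - 1))%:E * \int[mu]_x (phi x * capped_max m N x `^ (p - 1))%:E)%E.
Proof.
move=> p1 fN.
have p0 : 0 < p by apply: lt_trans p1.
have p10 : 0 < p - 1 by rewrite subr_gt0.
have N0 : 0 <= N := le_trans mean_ge0 fN.
have pp0 : 0 <= p / (p - 1) by rewrite ltW// divr_gt0.
have mt k : measurable_fun setT (capped_max k N) := @measurable_capped_max k N.
have mtp k r : measurable_fun setT (fun x => capped_max k N x `^ r).
  exact: (measurableT_comp (measurable_powR r)).
elim: m => [|m IH].
  have tE x : capped_max 0 N x = f by rewrite /capped_max /= level_average0; apply/min_idPl.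
  under eq_integral do rewrite tE.
  under [in X in (_ <= X)%E]eq_integral do rewrite tE mulrC.
  rewrite integralZ_ge0 ?powR_ge0// phif.
  have -> : (\int[mu]_(x in [set: X]) (f `^ p)%:E = (f `^ p)%:E)%E.
    transitivity ((f `^ p)%:E * mu setT)%E; first exact: (integral_cst mu measurableT).
    by rewrite probability_setT mule1.
  rewrite -!EFinM -EFinD lee_fin.
  rewrite [_ * f]mulrC mulr_powRB1 ?mean_ge0// le_eqVlt; apply/orP; left; apply/eqP.
  by field; rewrite gt_eqF.
pose D x := capped_max m.+1 N x `^ (p - 1) - capped_max m N x `^ (p - 1).
have D0 x : 0 <= D x.
  rewrite subr_ge0 ge0_ler_powR ?nnegrE ?capped_max_ge0 ?(ltW p10)//.
  by rewrite le_min !ge_min lexx orbT le_max lexx.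
have DC : level_constant m.+1 D.
  move=> x y e; rewrite /D (@capped_max_cst m.+1 N _ _ e).
  by rewrite (level_constantW (leqnSn m) (@capped_max_cst m N) e).
have mD := measurable_level_constant DC.
have ms := measurable_level_constant (@level_average_cst m.+1).
have phit x r : 0 <= phi x * capped_max m N x `^ r by rewrite mulr_ge0// powR_ge0.
apply: (@le_trans _ _ (\int[mu]_x (capped_max m N x `^ p)%:E + (f `^ p / (p - 1))%:E
   + (p / (p - 1))%:E * \int[mu]_x (phi x * D x)%:E)%E).
  rewrite addeAC leeD2r//.
  have msD : measurable_fun setT (fun x => level_average m.+1 x * D x).
    exact: measurable_funM.
  have sD0 x : 0 <= level_average m.+1 x * D x by rewrite mulr_ge0// level_average_ge0.
  have csD0 x : 0 <= p / (p - 1) * (level_average m.+1 x * D x) by rewrite mulr_ge0.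
  have mcsD : measurable_fun setT (fun x => p / (p - 1) * (level_average m.+1 x * D x)).
    exact: measurable_funM.
  have tp0 k x : 0 <= capped_max k N x `^ p by rewrite powR_ge0.
  rewrite -(integral_level_average D0 DC) -integralZ_ge0// -integralD_ge0//.
  apply: integral_le_ge0 => //; first exact: measurable_funD.
  by move=> x; exact: capped_maxS_le.
apply: (le_trans (leeD2r _ IH)).
have phiD0 x : 0 <= phi x * D x by rewrite mulr_ge0.
have mphiD : measurable_fun setT (fun x => phi x * D x) by exact: measurable_funM.
have mphit : measurable_fun setT (fun x => phi x * capped_max m N x `^ (p - 1)).
  exact: measurable_funM.
rewrite -ge0_muleDr; last 2 first.
- by apply: integral_ge0 => x _; rewrite lee_fin.
- by apply: integral_ge0 => x _; rewrite lee_fin.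
rewrite lee_wpmul2l ?lee_fin// -integralD_ge0//.
rewrite le_eqVlt; apply/orP; left; apply/eqP; apply: eq_integral => x _.
by rewrite -mulrDr /D addrC subrK.
Qed.

(** Young's inequality with weight [beta + 1] turns [capped_max_linear] into this bound
after absorbing a multiple of the left-hand integral, which is finite because of
the cap [N]. *)
Lemma capped_max_power (p q N beta : R) m :
  1 < p -> 1 <= q -> q <= p -> 0 < beta -> f <= N ->
  (\int[mu]_x (capped_max m N x `^ p)%:E +
     (q * (beta + 1) / ((p - 1) * q * beta + (p - q)) * f `^ p)%:E <=
   (p * (beta + 1) `^ q / ((p - 1) * q * beta + (p - q)))%:E *
     \int[mu]_x (phi x `^ q * capped_max m N x `^ (p - q))%:E)%E.
Proof.
move=> p1 q1 qp beta0 fN; set D := _ * beta + _; set K := p * _ / D.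
have p10 : 0 < p - 1 by rewrite subr_gt0.
have p0 : 0 < p by lra.
have q0 : 0 < q by lra.
have b0 : 0 < beta + 1 by lra.
have D0 : 0 < D by rewrite ltr_wpDr ?subr_ge0// !mulr_gt0.
have N0 : 0 <= N := le_trans mean_ge0 fN.
have bq0 : 0 < (beta + 1) `^ q by rewrite powR_gt0.
have mtp r : measurable_fun setT (fun x => capped_max m N x `^ r).
  exact: (measurableT_comp (measurable_powR r) (@measurable_capped_max m N)).
have mphiq : measurable_fun setT (fun x => phi x `^ q).
  exact: (measurableT_comp (measurable_powR q) mphi).
have tp0 r x : 0 <= capped_max m N x `^ r by rewrite powR_ge0.
have psi0 x : 0 <= phi x `^ q * capped_max m N x `^ (p - q)
  by rewrite mulr_ge0// powR_ge0.
have mpsi : measurable_fun setT (fun x => phi x `^ q * capped_max m N x `^ (p - q)).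
  exact: measurable_funM.
have jfin : (\int[mu]_x (capped_max m N x `^ p)%:E)%E \is a fin_num.
  rewrite ge0_fin_numE; last by apply: integral_ge0 => x _; rewrite lee_fin.
  apply: (@le_lt_trans _ _ (\int[mu]_x (cst (N `^ p) x)%:E)%E).
    apply: integral_le_ge0 => // x.
    rewrite ge0_ler_powR ?nnegrE ?capped_max_ge0 ?(ltW p0)//.
    by rewrite ge_min lexx orbT.
  have -> : (\int[mu]_x (cst (N `^ p) x)%:E = (N `^ p)%:E * mu setT)%E.
    exact: (integral_cst mu measurableT (N `^ p)%:E).
  by rewrite probability_setT mule1 ltry.
have lin := capped_max_linear m p1 fN.
set c1 := (beta + 1) `^ (q - 1) / q; set c2 := (q - 1) / (q * (beta + 1)).
have c10 : 0 <= c1 by rewrite divr_ge0 ?powR_ge0 ?(ltW q0).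
have c20 : 0 <= c2 by rewrite divr_ge0 ?subr_ge0// ltW// mulr_gt0.
have young : (\int[mu]_x (phi x * capped_max m N x `^ (p - 1))%:E <=
    c1%:E * \int[mu]_x (phi x `^ q * capped_max m N x `^ (p - q))%:E +
    c2%:E * \int[mu]_x (capped_max m N x `^ p)%:E)%E.
  have m1 : measurable_fun setT (fun x => c1 * (phi x `^ q * capped_max m N x `^ (p - q))).
    exact: measurable_funM.
  have m2 : measurable_fun setT (fun x => c2 * capped_max m N x `^ p).
    exact: measurable_funM.
  rewrite -!integralZ_ge0// -integralD_ge0//; last 2 first.
  - by move=> x; rewrite mulr_ge0.
  - by move=> x; rewrite mulr_ge0.
  apply: integral_le_ge0 => //.
  - exact: measurable_funM.
  - exact: measurable_funD.
  - by move=> x; rewrite mulr_ge0.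
  - by move=> x; apply: powR_young => //; exact: capped_max_ge0.
have pp0 : 0 < p / (p - 1) by rewrite divr_gt0.
have {lin young} := le_trans lin (lee_wpmul2l (ltW pp0 : (0 <= (p / (p - 1))%:E)%E) young).
have K0 : 0 < K by rewrite divr_gt0 ?mulr_gt0.
have : (0 <= \int[mu]_x (phi x `^ q * capped_max m N x `^ (p - q))%:E)%E.
  by apply: integral_ge0 => x _; rewrite lee_fin.
rewrite -(fineK jfin); set j := fine _.
case: (integral _ _ _) => [r _|_ _|//]; last by rewrite gt0_muley ?leey// lte_fin.
rewrite -!(EFinM, EFinD) !lee_fin => h.
set F := f `^ p in h *.
(* The factor by which one divides to isolate [j]: the inverse of
   [1 - p / (p - 1) * c2]. *)
have W0 : 0 <= (p - 1) * q * (beta + 1) / D by rewrite divr_ge0 ?(ltW D0)// !mulr_ge0 ?ltW.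
have := ler_wpM2l W0 h; rewrite -subr_ge0 => {}h; rewrite -subr_ge0.
apply: le_trans h _; rewrite le_eqVlt; apply/orP; left; apply/eqP.
rewrite /K -(mulr_powRB1 (ltW b0) q0) /c1 /c2 /D.
by field; rewrite !gt_eqF.
Qed.

Lemma level_averageE m I x : level m I -> I x ->
  ((mu I)^-1 * \int[mu]_(y in I) `|phi y|%:E)%E = (level_average m x)%:E.
Proof.
move=> mI Ix; have TI := level_sub treeT mI.
under eq_integral do rewrite ger0_norm//.
rewrite (tree_averageE treeT)// -(fineK (integral_tree_fin TI)) -EFinM.
by rewrite /level_average (level_cellE mI Ix).
Qed.

Lemma tree_maximalE x :
  tree_maximal mu T phi x = ereal_sup (range (fun m => (level_average m x)%:E)).
Proof.
congr ereal_sup; apply/seteqP; split=> [_ [I [TI Ix] <-]|_ [m _ <-]].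
  move: TI; rewrite (tree_levels treeT) => -[m _ mI].
  by exists m => //; rewrite (level_averageE mI Ix).
have [mI Ix] := level_cellP m x.
exists (level_cell m x); first by split=> //; exact: tree_level_cell.
exact: level_averageE.
Qed.

Lemma measurable_tree_maximal : measurable_fun setT (tree_maximal mu T phi).
Proof.
rewrite (_ : tree_maximal mu T phi =
    fun x => esups (fun m => (level_average m x)%:E) 0%N).
  apply: measurable_fun_esups => m; apply/measurable_EFinP.
  exact: measurable_level_constant (@level_average_cst m).
apply/funext => x; rewrite tree_maximalE; congr ereal_sup.
by apply/seteqP; split=> _ [m _ <-]; exists m.
Qed.

Lemma tree_maximal_ge0 x : (0 <= tree_maximal mu T phi x)%E.
Proof.
rewrite tree_maximalE; apply: (@le_trans _ _ (level_average 0 x)%:E).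
  by rewrite lee_fin level_average_ge0.
by apply: ereal_sup_ubound; exists 0%N.
Qed.

Lemma running_max_le_tree_maximal m x :
  ((running_max m x)%:E <= tree_maximal mu T phi x)%E.
Proof.
have le k : ((level_average k x)%:E <= tree_maximal mu T phi x)%E.
  by rewrite tree_maximalE; apply: ereal_sup_ubound; exists k.
elim: m => [|m IH] /=; first exact: le.
by rewrite EFin_max ge_max IH le.
Qed.

Lemma running_max_homo x : {homo running_max ^~ x : m k / (m <= k)%N >-> m <= k}.
Proof.
by apply: homo_leq => // [? ? ?|m]; [exact: le_trans|rewrite /= le_max lexx].
Qed.

Lemma level_average_le_running_max m x : level_average m x <= running_max m x.
Proof. by case: m => [|m] /=; rewrite ?le_max ?lexx ?orbT. Qed.

(** The cap [f + k] grows with the level, so in the supremum neither the cap nor the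
level truncation is felt. *)
Lemma tree_maximal_power_le_sup (p : R) x : 0 < p ->
  (tree_maximal mu T phi x `^ p <=
   ereal_sup (range (fun k => (capped_max k (f + k%:R) x `^ p)%:E)))%E.
Proof.
move=> p0; set s := ereal_sup _.
have tk k : ((capped_max k (f + k%:R) x `^ p)%:E <= s)%E.
  by apply: ereal_sup_ubound; exists k.
have : (0 <= s)%E by apply: le_trans (tk 0%N); rewrite lee_fin powR_ge0.
case: s tk => [s tk s0|_ _|//]; last by rewrite leey.
rewrite lee_fin in s0.
have root k : capped_max k (f + k%:R) x <= s `^ p^-1.
  have t0 : 0 <= capped_max k (f + k%:R) x by rewrite capped_max_ge0// addr_ge0// mean_ge0.
  have := tk k; rewrite lee_fin => /(ge0_ler_powR (r := p^-1)).
  rewrite invr_ge0 (ltW p0) !nnegrE powR_ge0 => /(_ isT isT s0).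
  by rewrite -powRrM divff ?gt_eqF// powRr1.
have run k : running_max k x <= s `^ p^-1.
  (* At level [j] the cap exceeds the bound, so it is not the smaller one. *)
  pose j := maxn k (Num.truncn (s `^ p^-1)).+1.
  apply: le_trans (running_max_homo x (leq_maxl k (Num.truncn (s `^ p^-1)).+1)) _.
  have := root j; rewrite ge_min => /orP[//|].
  move=> h; exfalso; move: h; apply/negP; rewrite -ltNge.
  apply: (lt_le_trans (truncnS_gt (s `^ p^-1))).
  by rewrite (@le_trans _ _ j%:R) ?ler_nat ?leq_maxr// lerDr mean_ge0.
have : (tree_maximal mu T phi x <= (s `^ p^-1)%:E)%E.
  rewrite tree_maximalE; apply: ge_ereal_sup => _ [m _ <-].
  by rewrite lee_fin (le_trans (level_average_le_running_max m x)).
have := tree_maximal_ge0 x.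
case: tree_maximal => [M M0 Ms|//|//].
rewrite poweR_EFin lee_fin -[leRHS](powRr1 s0) -(mulVf (lt0r_neq0 p0)) powRrM.
by rewrite ge0_ler_powR ?nnegrE ?powR_ge0 ?(ltW p0).
Qed.

(** The bound [capped_max_power] in the limit where level and cap go to infinity. On
the right the capped maximum can be replaced by the maximal function before the
limit, since [p - q >= 0]; on the left monotone convergence applies. *)
Lemma tree_maximal_bound (p q beta : R) :
  1 < p -> 1 <= q -> q <= p -> 0 < beta ->
  (\int[mu]_x (tree_maximal mu T phi x `^ p) +
     (q * (beta + 1) / ((p - 1) * q * beta + (p - q)) * f `^ p)%:E <=
   (p * (beta + 1) `^ q / ((p - 1) * q * beta + (p - q)))%:E *
     \int[mu]_x ((phi x)%:E `^ q * tree_maximal mu T phi x `^ (p - q)))%E.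
Proof.
move=> p1 q1 qp beta0; set D := _ * beta + _; set K := p * _ / D.
have p0 : 0 < p by lra.
have D0 : 0 < D by rewrite ltr_wpDr ?subr_ge0// !mulr_gt0//; lra.
have K0 : 0 < K by rewrite divr_gt0 ?mulr_gt0 ?powR_gt0//; lra.
have fk k : f <= f + k%:R by rewrite lerDl.
have fk0 k : 0 <= f + k%:R := le_trans mean_ge0 (fk k).
pose t k x : R := capped_max k (f + k%:R) x.
have t0 k x : 0 <= t k x by exact: capped_max_ge0.
have mt k : measurable_fun setT (t k) := @measurable_capped_max k _.
have mtp k r : measurable_fun setT (fun x => t k x `^ r).
  exact: (measurableT_comp (measurable_powR r)).
have mM := measurable_tree_maximal.
have mMr r : measurable_fun setT (fun x => tree_maximal mu T phi x `^ r)%E.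
  exact: (measurableT_comp (measurable_poweR r)).
have mphiq : measurable_fun setT (fun x => (phi x)%:E `^ q)%E.
  by apply: (measurableT_comp (measurable_poweR q)); exact/measurable_EFinP.
have tM k x : ((t k x)%:E <= tree_maximal mu T phi x)%E.
  apply: le_trans (running_max_le_tree_maximal k x).
  by rewrite lee_fin ge_min lexx.
set B := (K%:E * _)%E.
have tB k : (\int[mu]_x (t k x `^ p)%:E + (q * (beta + 1) / D * f `^ p)%:E <= B)%E.
  apply: (le_trans (capped_max_power k p1 q1 qp beta0 (fk k))).
  rewrite /B lee_wpmul2l// ?lee_fin ?(ltW K0)//.
  apply: ge0_le_integral => //.
  - by move=> x _; rewrite lee_fin mulr_ge0 ?powR_ge0.
  - apply/measurable_EFinP; apply: measurable_funM; last exact: mtp.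
    exact: (measurableT_comp (measurable_powR q)).
  - exact: emeasurable_funM.
  - move=> x _; rewrite EFinM -!poweR_EFin lee_wpmul2l ?poweR_ge0//.
    by apply: gt0_ler_poweR; rewrite ?subr_ge0 ?in_itv /=
       ?leey ?andbT ?lee_fin ?t0 ?tree_maximal_ge0 ?tM.
have nd x : nondecreasing_seq (fun k => (t k x `^ p)%:E).
  move=> i j ij; rewrite lee_fin ge0_ler_powR ?nnegrE ?t0 ?(ltW p0)//.
  rewrite /t /capped_max le_min !ge_min (running_max_homo x ij) /=.
  by rewrite lerD2l ler_nat ij orbT.
have cvt x : ((t k x `^ p)%:E @[k --> \oo] -->
    ereal_sup (range (fun k => (t k x `^ p)%:E)))%E.
  exact: ereal_nondecreasing_cvgn (nd x).
have cvI : (\int[mu]_x (t k x `^ p)%:E @[k --> \oo] -->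
    \int[mu]_x limn (fun k => (t k x `^ p)%:E))%E.
  apply: cvg_monotone_convergence => //.
  - by move=> k; exact/measurable_EFinP.
  - by move=> k x _; rewrite lee_fin powR_ge0.
have MI : (\int[mu]_x (tree_maximal mu T phi x `^ p) <=
    \int[mu]_x limn (fun k => (t k x `^ p)%:E))%E.
  apply: ge0_le_integral => //.
  - by move=> x _; exact: poweR_ge0.
  - apply: (emeasurable_fun_cvg (fun k x => (t k x `^ p)%:E)) => [k|x _].
      exact/measurable_EFinP.
    by rewrite (cvg_lim _ (cvt x)).
  - by move=> x _; rewrite (cvg_lim _ (cvt x))//; exact: tree_maximal_power_le_sup.
rewrite -leeBrDr//; apply: (le_trans MI); apply: (cvge_le _ cvI).
by apply: nearW => k; rewrite leeBrDr.
Qed.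

End levels.

(** * Sharpness and the theorem *)

Lemma Lfun_ge0 (d : measure_display) (X : measurableType d) (R : realType)
    (mu : probability X R) (p : R) (phi : X -> R) :
  measurable_fun setT phi -> (forall x, 0 <= phi x) ->
  (\int[mu]_x ((phi x)%:E `^ p) < +oo)%E -> phi \in Lfun mu p%:E.
Proof.
move=> mphi phi0 phip; rewrite inE; apply/andP; split; rewrite inE//=.
rewrite /finite_norm unlock /Lnorm; apply: poweR_lty.
by under eq_integral do rewrite /= ger0_norm//.
Qed.

(** The comparison of [M ^ p] with [K * phi ^ q * M ^ (p - q)] is made pointwise at
[t = M x >= rho * phi x] by [powR_maximal_trade]. The integral of [M ^ p] is finite
by [tree_maximal_bound] with exponent [q := p]. *)
Lemma tree_maximal_sharp (d : measure_display) (X : measurableType d) (R : realType)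
    (mu : probability X R) (T : set (set X)) (C0 : set X -> set (set X))
    (p q f beta C : R) :
  is_tree_with mu T C0 -> 1 < p -> 1 <= q -> q <= p -> 0 < f ->
  0 < beta -> beta <= 1 / (p - 1) ->
  q * (beta + 1) / ((p - 1) * q * beta + (p - q)) < C ->
  exists phi : X -> R, [/\ phi \in Lfun mu p%:E, forall x : X, 0 <= phi x,
    (\int[mu]_x (phi x)%:E = f%:E)%E &
    (\int[mu]_x (tree_maximal mu T phi x `^ p) > (- C * f `^ p)%R%:E
       + (p * (beta + 1) `^ q / ((p - 1) * q * beta + (p - q)))%R%:E
         * \int[mu]_x ((phi x)%:E `^ q * tree_maximal mu T phi x `^ (p - q)))%E].
Proof.
move=> treeT p1 q1 qp f0 beta0 betap CC.
have [u [a [/andP[u0 u1] /andP[a0 a1] Kr Ku [g1 gC]]]] :=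
  extremal_parameters p1 q1 qp beta0 betap CC.
move: Kr Ku gC; set D := _ * beta + _; set K := p * _ / D => Kr Ku gC.
have p0 : 0 < p by lra.
have D0 : 0 < D by rewrite ltr_wpDr ?subr_ge0// !mulr_gt0//; lra.
have K0 : 0 < K by rewrite divr_gt0 ?mulr_gt0 ?powR_gt0//; lra.
set theta := 1 - a in g1 gC; set gam := (1 - a * u) / theta in g1 gC.
have t0 : 0 < theta by rewrite subr_gt0.
have t1 : theta < 1 by rewrite /theta; lra.
have au1 : a * u < 1 by rewrite -(mul1r 1) ltr_pM// ltW.
have gam0 : 0 < gam by rewrite divr_gt0// subr_gt0.
have gt : gam * theta = 1 - a * u by rewrite /gam divfK ?gt_eqF.
have gt1 : gam * theta < 1 by rewrite gt ltrBlDr ltrDl mulr_gt0.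
(* The factor [f * u] normalizes the mean: the averages are [u^-1] times the values. *)
have fu0 : 0 <= f * u by rewrite mulr_ge0 ?ltW.
rewrite mulrC in g1.
have [phi [mphi phi0 phif phip phiM]] :=
  extremal_function treeT t0 t1 gam0 gt1 p0 g1 fu0.
have rhoE : (1 - theta) / (1 - gam * theta) = u^-1.
  by rewrite gt /theta !subKr invfM mulrA divff ?gt_eqF// mul1r.
have thetaE : 1 - theta = a by rewrite /theta subKr.
rewrite rhoE in phif phiM; rewrite mulfK ?gt_eqF// in phif.
rewrite thetaE mulrC in phip.
have mM := measurable_tree_maximal treeT mphi phi0 phif.
have M0 := tree_maximal_ge0 treeT mphi phi0 phif.
have mMr r : measurable_fun setT (fun x => tree_maximal mu T phi x `^ r)%E.
  exact: (measurableT_comp (measurable_poweR r)).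
have mphir r : measurable_fun setT (fun x => (phi x)%:E `^ r)%E.
  by apply: (measurableT_comp (measurable_poweR r)); exact/measurable_EFinP.
exists phi; split=> //; first by apply: Lfun_ge0 => //; rewrite phip ltry.
have Mfin : (\int[mu]_x (tree_maximal mu T phi x `^ p) < +oo)%E.
  have := tree_maximal_bound treeT mphi phi0 phif p1 (ltW p1) (lexx p) beta0.
  rewrite subrr; under [in X in (_ <= X)%E]eq_integral do rewrite poweRe0 mule1.
  rewrite phip -EFinM => h; apply: le_lt_trans (ltry _); last first.
  apply: le_trans h; rewrite leeDl// lee_fin addr0.
  by rewrite !mulr_ge0 ?powR_ge0 ?invr_ge0 ?mulr_ge0//; lra.
set rho := u^-1 in phiM Kr.
have rho0 : 0 < rho by rewrite invr_gt0.
pose kappa := K * rho `^ (p - q) - rho `^ p.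
have rhor r : rho `^ r * u `^ r = 1.
  by rewrite -powRM ?(ltW u0) ?(ltW rho0)// mulVf ?gt_eqF// powR1.
have kappaE : kappa * u `^ p = K * u `^ q - 1.
  rewrite /kappa mulrBl rhor; congr (_ - _).
  have -> : u `^ p = u `^ (p - q) * u `^ q by rewrite -powRD ?subrK// (gt_eqF u0) implybT.
  by rewrite mulrA -[K * _ * _]mulrA rhor mulr1.
have kappa0 : 0 <= kappa.
  by rewrite -(pmulr_lge0 _ (powR_gt0 p u0)) kappaE subr_ge0.
have trade x : (K%:E * ((phi x)%:E `^ q * tree_maximal mu T phi x `^ (p - q)) <=
    tree_maximal mu T phi x `^ p + kappa%:E * (phi x)%:E `^ p)%E.
  have := phiM x; have := M0 x.
  case: tree_maximal => [M M_ge0 Mphi|_ _|//]; last first.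
    by rewrite [X in (_ <= X + _)%E]poweRyr ?gt_eqF// addye ?leey//.
  rewrite !poweR_EFin -!EFinM -EFinD lee_fin.
  by apply: powR_maximal_trade => //; exact: ltW.
have integrated :
    (K%:E * \int[mu]_x ((phi x)%:E `^ q * tree_maximal mu T phi x `^ (p - q)) <=
    \int[mu]_x (tree_maximal mu T phi x `^ p) +
    kappa%:E * \int[mu]_x ((phi x)%:E `^ p))%E.
  have prod0 x : (0 <= (phi x)%:E `^ q * tree_maximal mu T phi x `^ (p - q))%E.
    by rewrite mule_ge0 ?poweR_ge0.
  have mprod : measurable_fun setT
      (fun x => (phi x)%:E `^ q * tree_maximal mu T phi x `^ (p - q))%E.
    exact: emeasurable_funM.
  have k0 x : (0 <= kappa%:E * (phi x)%:E `^ p)%E by rewrite mule_ge0 ?poweR_ge0.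
  have mk : measurable_fun setT (fun x => kappa%:E * (phi x)%:E `^ p)%E.
    exact: measurable_funeM.
  rewrite -!ge0_integralZl ?lee_fin ?(ltW K0)//; last by move=> x _; exact: poweR_ge0.
  rewrite -ge0_integralD//; last by move=> x _; exact: poweR_ge0.
  apply: ge0_le_integral => //.
  - by move=> x _; rewrite mule_ge0// lee_fin ltW.
  - exact: measurable_funeM.
  - exact: emeasurable_funD.
have small : kappa * (a / (1 - gam `^ p * theta) * (f * u) `^ p) < C * f `^ p.
  rewrite (powRM _ (ltW f0) (ltW u0)).
  have -> : kappa * (a / (1 - gam `^ p * theta) * (f `^ p * u `^ p)) =
      (kappa * u `^ p) * a / (1 - gam `^ p * theta) * f `^ p by ring.
  by rewrite kappaE ltr_pM2r ?powR_gt0// [gam `^ p * _]mulrC.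
move: integrated; rewrite phip -EFinM.
have := integral_ge0 mu (fun x (_ : setT x) => poweR_ge0 (tree_maximal mu T phi x) p).
move: Mfin; case: (integral _ _ (fun x => tree_maximal mu T phi x `^ p)%E) => [m _ _|//|//].
case: (_ * _)%E => [k|//|]; last by rewrite addeNy ltNye.
rewrite -!EFinD lee_fin lte_fin; lra.
Qed.

Theorem theorem1 (d : measure_display) (X : measurableType d) (R : realType)
    (mu : probability X R) (mu_na : non_atomic mu)
    (T : set (set X)) (T_tree : is_tree mu T)
    (p : R) (p_gt1 : 1 < p) :
  (forall (q : R) (phi : X -> R) (f beta : R),
      1 <= q -> q <= p ->
      phi \in Lfun mu p%:E ->
      (forall x : X, 0 <= phi x) ->
      (\int[mu]_x (phi x)%:E = f%:E)%E ->
      0 < beta ->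
      (\int[mu]_x (tree_maximal mu T phi x `^ p)
        <= (- (q * (beta + 1) / ((p - 1) * q * beta + (p - q))) * f `^ p)%R%:E
           + (p * (beta + 1) `^ q / ((p - 1) * q * beta + (p - q)))%R%:E
             * \int[mu]_x ((phi x)%:E `^ q
                           * tree_maximal mu T phi x `^ (p - q)))%E)
  /\
  (forall q f beta : R,
      1 <= q -> q <= p ->
      0 < f ->
      0 < beta -> beta <= 1 / (p - 1) ->
      forall C : R,
        q * (beta + 1) / ((p - 1) * q * beta + (p - q)) < C ->
        exists phi : X -> R,
          [/\ phi \in Lfun mu p%:E,
              forall x : X, 0 <= phi x,
              (\int[mu]_x (phi x)%:E = f%:E)%E &
              (\int[mu]_x (tree_maximal mu T phi x `^ p)
                > (- C * f `^ p)%R%:E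
                  + (p * (beta + 1) `^ q
                       / ((p - 1) * q * beta + (p - q)))%R%:E
                    * \int[mu]_x ((phi x)%:E `^ q
                                  * tree_maximal mu T phi x `^ (p - q)))%E]).
Proof.
have [C0 treeT] := T_tree; split.
  move=> q phi f beta q1 qp /sub_Lfun_mfun; rewrite inE => mphi phi0 phif beta0.
  rewrite mulNr EFinN addeC leeBrDr//.
  exact: (tree_maximal_bound treeT mphi phi0 phif).
by move=> q f beta q1 qp f0 beta0 betap C CC; exact: (tree_maximal_sharp treeT).
Qed.
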